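(* Fix $k\in\mathbb Z$ and let $(p,q)$ range over the couples of nonnegative integers, not vanishing simultaneously, such that $p-q=k$. (i) The function $A_{pq}(\,\cdot\,)$ on nonempty Young diagrams satisfies $$A_{pq}(\lambda)=\sum_{\nu\searrow\lambda}\tilde p_k(\lambda,\nu)A_{pq}(\nu)\qquad\text{for all }\lambda\in\mathbb Y,\ \lambda\ne\varnothing .$$ Therefore, it determines an operator $A_{pq}$ in the commutant $\mathcal A$ of the representation $T_k$. (ii) Each operator $A_{pq}$ is an orthogonal projection onto a subspace $H_{pq}\subset H$. The subspaces $H_{pq}$ are pairwise orthogonal, and their direct sum is the whole $H$. Thus they determine a decomposition of $T_k$ into a direct sum of subrepresentations $$T_k=\bigoplus_{p-q=k}T_{pq},\qquad (p,q)\in\mathbb Z_+^2\setminus\{(0,0)\}.$$ (iii) Denote by $\mathrm{Reg}^n_{pq}$, where $n$ is large enough, the subrepresentation of $\mathrm{Reg}^n$ which is the sum of the components $\pi^\lambda\times\pi^\lambda$ with $\lambda\in\mathbb Y_n\cap\mathbb Y(p,q)$, and let $H^n_{pq}\subset H^n$ be the corresponding subspace. Then the isometric embedding $L_k^n:H^n\to H^{n+1}$ maps $H^n_{pq}$ into $H^{n+1}_{pq}$, and the representation $T_{pq}\subset T_k$ coincides with the inductive limit of the representations $\mathrm{Reg}^n_{pq}\subset\mathrm{Reg}^n$ as $n\to\infty$.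
   Context: $S(n)$ is the group of permutations of $\{1,\dots,n\}$, identified with the stabilizer of $n+1$ in $S(n+1)$; $S(\infty)=\bigcup_n S(n)$; $G=S(\infty)\times S(\infty)$, $G(n)=S(n)\times S(n)$. The canonical projection $p_{n,n+1}:S(n+1)\to S(n)$ removes $n+1$ from its cycle: for $1\le i\le n$, $(p_{n,n+1}(x))(i)=x(i)$ if $x(i)\le n$, and $=x(n+1)$ if $x(i)=n+1$. $H^n=L^2(S(n))$ with respect to the uniform probability measure; $\mathrm{Reg}^n$ is the representation of $G(n)$ in $H^n$, $(\mathrm{Reg}^n(g)f)(x)=f(g_2^{-1}xg_1)$. For $z\in\mathbb C$, $t=|z|^2$, the isometric $G(n)$-equivariant embedding $L_z^n:H^n\to H^{n+1}$ is $(L_z^nf)(x)=z\sqrt{\frac{n+1}{t+n}}f(x)$ for $x\in S(n)$ and $(L_z^nf)(x)=\sqrt{\frac{n+1}{t+n}}f(p_{n,n+1}(x))$ for $x\in S(n+1)\setminus S(n)$. $T_z$ is the inductive limit of the $\mathrm{Reg}^n$ along the $L_z^n$, acting in the Hilbert completion $H$ of $\bigcup_nH^n$; here $z=k$. $\mathbb Y_n$ is the set of Young diagrams with $n$ boxes, $\mathbb Y=\bigcup_n\mathbb Y_n$; $\lambda\nearrow\nu$ (equivalently $\nu\searrow\lambda$) means that $\nu$ is obtained from $\lambda$ by adding one box; $\pi^\lambda$ is the irreducible representation of $S(n)$ indexed by $\lambda\in\mathbb Y_n$, $\dim\lambda=\dim\pi^\lambda$. $\mathrm{Reg}^n=\bigoplus_{\lambda\in\mathbb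 Y_n}(\pi^\lambda\times\pi^\lambda)$; $H(\lambda)\subset H^n$ is the corresponding subspace, $P(\lambda):H\to H(\lambda)$ and $P_n:H\to H^n$ are the orthogonal projections. The transition function $\tilde p_z(\lambda,\nu)$ ($\lambda\in\mathbb Y_n$, $n\ge 1$, $\lambda\nearrow\nu$) is defined by $\|P(\nu)\xi\|^2=\tilde p_z(\lambda,\nu)\|\xi\|^2$ for all $\xi\in H(\lambda)$. (Explicitly $\tilde p_z(\lambda,\nu)=\frac{|z+c|^2}{|z|^2+n}\cdot\frac{\dim\nu}{(n+1)\dim\lambda}$, where $c=j-i$ is the content of the added box $(i,j)$.) The commutant $\mathcal A$ of $T_z$ is in bijection with the bounded complex functions $A(\,\cdot\,)$ on nonempty Young diagrams satisfying $A(\lambda)=\sum_{\nu\searrow\lambda}\tilde p_z(\lambda,\nu)A(\nu)$ for all $\lambda\neq\varnothing$: the operator $A\in\mathcal A$ corresponding to $A(\,\cdot\,)$ is determined by $P_nAP_n=\sum_{\lambda\in\mathbb Y_n}A(\lambda)P(\lambda)$ for all $n\ge1$. The sets $\mathbb Y(p,q)$: for $p,q\ge1$, $\mathbb Y(p,q)$ is the set of diagrams containing the box $(p,q)$ but not the box $(p+1,q+1)$; $\mathbb Y(p,0)$, $p\ge1$, is the set of diagrams with at most $p$ rows; $\mathbb Y(0,q)$, $q\ge1$, is the set of diagrams with at most $q$ columns. $A_{pq}(\,\cdot\,)$ is the characteristic function of $\mathbb Y(p,q)\setminus\{\varnothing\}$ on the set of nonempty diagrams. *)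

(* Defs.v *)
Set Warnings "-notation-overridden,-ambiguous-paths,-redundant-canonical-projection,-projection-no-head-constant".
From HB Require Import structures.
From mathcomp Require Import all_boot all_order all_algebra all_fingroup.
From mathcomp Require Import mxrepresentation sesquilinear.
From mathcomp Require Import boolp classical_sets reals topology normedtype.
From mathcomp Require Import complex.

Set Implicit Arguments.
Unset Strict Implicit.
Unset Printing Implicit Defensive.

Import Order.TTheory GRing.Theory Num.Theory.
Import numFieldNormedType.Exports.

Local Open Scope classical_set_scope.
Local Open Scope complex_scope.
Local Open Scope ring_scope.

(* {1, ..., n} is encoded as 'I_n, with i standing for i.+1, so that n+1 is
   [ord_max : 'I_n.+1].  The product (s * t)%g of 'S_n applies s first: the
   composition product x y of permutations is written (y * x)%g below. *)

Section FiniteGroups.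
Variable n : nat.

Definition canonical_projection_fun (x : 'S_n.+1) (i : 'I_n) : 'I_n :=
  if unlift ord_max (x (lift ord_max i)) is Some j then j
  else odflt i (unlift ord_max (x ord_max)).

Lemma canonical_projection_inj (x : 'S_n.+1) :
  injective (canonical_projection_fun x).
Proof.
move=> i j; rewrite /canonical_projection_fun.
have neq k : x ord_max != x (lift ord_max k).
  by rewrite (inj_eq perm_inj) neq_lift.
case: (unliftP ord_max (x (lift ord_max i))) => [a|] Ei;
  case: (unliftP ord_max (x (lift ord_max j))) => [b|] Ej.
- by move=> ab; apply/(@lift_inj _ ord_max)/(@perm_inj _ x); rewrite Ei Ej ab.
- case: (unliftP ord_max (x ord_max)) => [c|] Ec; last first.
    by have := neq j; rewrite Ec Ej eqxx.
  by move=> /= ac; have := neq i; rewrite Ec Ei ac eqxx.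
- case: (unliftP ord_max (x ord_max)) => [c|] Ec; last first.
    by have := neq i; rewrite Ec Ei eqxx.
  by move=> /= cb; have := neq j; rewrite Ec Ej cb eqxx.
- by move=> _; apply/(@lift_inj _ ord_max)/(@perm_inj _ x); rewrite Ei Ej.
Qed.

Definition canonical_projection (x : 'S_n.+1) : 'S_n :=
  perm (@canonical_projection_inj x).

End FiniteGroups.

Record Sinf := MkSinf {
  Sinf_fun :> nat -> nat;
  Sinf_bij : bijective Sinf_fun;
  Sinf_fin : exists n, forall i, (n <= i)%N -> Sinf_fun i = i }.

Lemma Sinf_one_fin : exists n, forall i, (n <= i)%N -> @id nat i = i.
Proof. by exists 0%N. Qed.

Definition Sinf_one : Sinf := MkSinf (Bijective (frefl id) (frefl id) : bijective (@id nat)) Sinf_one_fin.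

Lemma Sinf_mul_fin (g h : Sinf) :
  exists n, forall i, (n <= i)%N -> (g \o h) i = i.
Proof.
have [m gm] := Sinf_fin g; have [p hp] := Sinf_fin h.
exists (maxn m p) => i; rewrite geq_max => /andP[mi pi] /=.
by rewrite hp // gm.
Qed.

Definition Sinf_mul (g h : Sinf) : Sinf :=
  MkSinf (bij_comp (Sinf_bij g) (Sinf_bij h)) (Sinf_mul_fin g h).

Definition G : Type := (Sinf * Sinf)%type.
Definition G_one : G := (Sinf_one, Sinf_one).
Definition G_mul (g h : G) : G := (Sinf_mul g.1 h.1, Sinf_mul g.2 h.2).

(* g is the element s of S(n), viewed in S(oo) *)
Definition Sinf_is n (g : Sinf) (s : 'S_n) : Prop :=
  (forall i : 'I_n, g i = s i) /\ (forall i, (n <= i)%N -> g i = i).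

Definition G_is n (g : G) (s : 'S_n * 'S_n) : Prop :=
  Sinf_is g.1 s.1 /\ Sinf_is g.2 s.2.

(* A Young diagram with n boxes is given by its row lengths, padded with zeros
   to n rows. *)
Section Diagrams.
Variable n : nat.

Record diagram := Diagram {
  rows : n.-tuple 'I_n.+1;
  _ : sorted geq (map val rows) && (sumn (map val rows) == n) }.

HB.instance Definition _ := [isSub for rows].
HB.instance Definition _ := [Finite of diagram by <:].

Definition row_lengths (la : diagram) : seq nat := map val (rows la).
Definition row_length (la : diagram) (i : nat) : nat := nth 0%N (row_lengths la) i.
Definition num_rows (la : diagram) : nat := count (fun m => 0 < m)%N (row_lengths la).
Definition num_cols (la : diagram) : nat := row_length la 0.

(* boxes (i, j) are numbered from 1 *)
Definition has_box (la : diagram) (i j : nat) : bool :=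
  [&& 0 < i, 0 < j & j <= row_length la i.-1]%N.

Definition in_Ypq (p q : nat) (la : diagram) : bool :=
  if q == 0%N then (num_rows la <= p)%N
  else if p == 0%N then (num_cols la <= q)%N
  else has_box la p q && ~~ has_box la p.+1 q.+1.

(* The standard tableau of shape la filled row after row: the entry m sits in
   row [tab_row la m] and column [tab_col la m]. *)
Definition tab_row (la : diagram) (m : 'I_n) : nat :=
  reshape_index (row_lengths la) m.
Definition tab_col (la : diagram) (m : 'I_n) : nat :=
  reshape_offset (row_lengths la) m.

Definition row_stab (la : diagram) : {set 'S_n} :=
  [set s : 'S_n | [forall m, tab_row la (s m) == tab_row la m]].
Definition col_stab (la : diagram) : {set 'S_n} :=
  [set s : 'S_n | [forall m, tab_col la (s m) == tab_col la m]].

End Diagrams.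

Definition adds_box n (la : diagram n) (nu : diagram n.+1) : bool :=
  [exists i : 'I_n.+1, forall j : 'I_n.+1,
     row_length nu j == (row_length la j + (j == i))%N].

Definition admissible (k : int) (pq : nat * nat) : bool :=
  (pq != (0%N, 0%N)) && (pq.1%:Z - pq.2%:Z == k).

Section Representations.
Variables (R : realType) (n : nat).
Local Notation C := R[i].

Definition L2 : Type := {ffun 'S_n -> C^o}.

Definition L2dot (f g : L2) : C := (n`!%:R)^-1 * \sum_x f x * (g x)^*.

(* (Reg(s) f)(x) = f(s_2^-1 x s_1) *)
Definition Reg (s : 'S_n * 'S_n) (f : L2) : L2 :=
  [ffun x => f (s.1 * x * s.2^-1)%g].

(* The Young symmetrizer of la, in the coordinates of [regular_repr]. *)
Definition young_symmetrizer (la : diagram n) : 'rV[C]_#|[set: 'S_n]%G| :=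
  \sum_(h in row_stab la) \sum_(v in col_stab la)
    (-1) ^+ odd_perm v *: delta_mx 0 (gring_index [set: 'S_n]%G (h * v)%g).

(* The Specht module pi^la: the ideal of the group algebra generated by the
   Young symmetrizer.  The operator of x is the right multiplication of row
   vectors by [irr la x]; in view of the convention on products, this is a left
   action for the composition product. *)
Definition specht_mx (la : diagram n) : 'M[C]_#|[set: 'S_n]%G| :=
  cyclic_mx (regular_repr C [set: 'S_n]%G) (young_symmetrizer la).

Definition irr (la : diagram n) :
    mx_representation C [set: 'S_n]%G (\rank (specht_mx la)) :=
  submod_repr (cyclic_mx_module (regular_repr C [set: 'S_n]%G)
                                (young_symmetrizer la)).

(* pi^la x pi^la acts on square matrices, v (x) w being the matrix v^T *m w.
   As it occurs exactly once in Reg^n, the images of the intertwining operators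
   into L2 make up a single subspace, H(la). *)
Definition irr2 (la : diagram n) (s : 'S_n * 'S_n)
    (M : 'M[C]_(\rank (specht_mx la))) : 'M[C]_(\rank (specht_mx la)) :=
  (irr la s.1)^T *m M *m irr la s.2.

Definition Hla (la : diagram n) : set L2 :=
  [set f | exists2 Phi : {linear 'M[C]_(\rank (specht_mx la)) -> L2},
      (forall s M, Phi (irr2 s M) = Reg s (Phi M)) & exists M, f = Phi M].

Definition Hnpq (p q : nat) : set L2 :=
  [set f | exists2 h : diagram n -> L2,
      (forall la, Hla la (h la)) & f = \sum_(la | in_Ypq p q la) h la].

End Representations.

(* Uses that the restriction of the canonical projection to S(n), i.e. to the
   permutations fixing n+1, is the identification of S(n) with that stabilizer. *)
Definition Lembed (R : realType) (z : R[i]) n (f : L2 R n) : L2 R n.+1 :=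
  [ffun x : 'S_n.+1 =>
     (if x ord_max == ord_max then z else 1) *
     sqrtC (n.+1%:R / (`|z| ^+ 2 + n%:R)) * f (canonical_projection x)].

Section HilbertSpace.
Variables (R : realType) (H : completeNormedModType R[i]).
Local Notation C := R[i].
Variable dot : {dot H for Num.conj}.

Definition subspace (V : lmodType C) (W : set V) : Prop :=
  W 0 /\ forall (a : C) x y, W x -> W y -> W (a *: x + y).

Definition orth_proj (W : set H) (x : H) : H :=
  xget 0 [set y | W y /\ forall w, W w -> dot (x - y) w = 0].

Definition is_orth_projection (P : H -> H) : Prop :=
  (forall x, P (P x) = P x) /\ (forall x y, dot (P x) y = dot x (P y)).

(* H is the Hilbert direct sum of the W i *)
Definition hilbert_direct_sum (I : Type) (W : I -> set H) : Prop :=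
  [/\ forall i, subspace (W i) /\ closed (W i),
      forall i j, i <> j -> forall x y, W i x -> W j y -> dot x y = 0
    & closure [set x | exists s : seq I, exists2 w : I -> H,
                 (forall i, W i (w i)) & x = \sum_(i <- s) w i] = setT].

Definition unitary_rep_on (T : G -> H -> H) (W : set H) : Prop :=
  [/\ forall g x, W x -> W (T g x),
      forall x, W x -> T G_one x = x,
      forall g h x, W x -> T (G_mul g h) x = T g (T h x)
    & forall g x y, W x -> W y -> dot (T g x) (T g y) = dot x y].

Variable iota : forall n, {linear L2 R n -> H}.

(* The restriction of T to W is the inductive limit, over n >= n0 and along the
   embeddings L_z^n, of the subrepresentations V n of Reg^n, the canonical
   isometries being the iota n; W is the completion of the union of the V n. *)
Record is_inductive_limit (z : C) (n0 : nat) (V : forall n, set (L2 R n))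
    (T : G -> {linear H -> H}) (W : set H) : Prop := IsInductiveLimit {
  il_subspace : forall n, (n0 <= n)%N -> subspace (V n);
  il_subrep : forall n, (n0 <= n)%N -> forall s f, V n f -> V n (Reg s f);
  il_embed : forall n, (n0 <= n)%N -> forall f, V n f -> V n.+1 (Lembed z f);
  il_isometry : forall n, (n0 <= n)%N -> forall f g, V n f -> V n g ->
    dot (iota n f) (iota n g) = L2dot f g;
  il_compat : forall n, (n0 <= n)%N -> forall f, V n f ->
    iota n.+1 (Lembed z f) = iota n f;
  il_completion :
    W = closure (\bigcup_(n in [set n | (n0 <= n)%N]) (iota n @` V n));
  il_unitary : unitary_rep_on T W;
  il_equivariant : forall n, (n0 <= n)%N -> forall g s, G_is g s ->
    forall f, V n f -> T g (iota n f) = iota n (Reg s f) }.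

(* T is T_z, acting in H.  The limit starts at n = 1: L_0^0 is undefined. *)
Definition is_T (z : C) (T : G -> {linear H -> H}) : Prop :=
  is_inductive_limit z 1 (fun n => [set: L2 R n]) T [set: H].

Definition P_n (n : nat) : H -> H := orth_proj (range (iota n)).
Definition P_la n (la : diagram n) : H -> H := orth_proj (iota n @` Hla la).

Definition transition n (la : diagram n) (nu : diagram n.+1) : R :=
  xget 0 [set r : R | forall xi, (iota n @` Hla la) xi ->
                        `|P_la nu xi| ^+ 2 = r%:C * `|xi| ^+ 2].

Definition in_commutant (T : G -> {linear H -> H}) (A : {linear H -> H}) : Prop :=
  continuous A /\ forall g x, A (T g x) = T g (A x).

Definition harmonic (a : forall n, diagram n -> C) : Prop :=
  forall n, (1 <= n)%N -> forall la : diagram n,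
    a n la = \sum_(nu : diagram n.+1 | adds_box la nu)
               (transition la nu)%:C * a n.+1 nu.

(* A is the operator corresponding to the function a on nonempty diagrams *)
Definition corresponds (a : forall n, diagram n -> C) (A : {linear H -> H}) : Prop :=
  forall n, (1 <= n)%N -> forall x,
    P_n n (A (P_n n x)) = \sum_(la : diagram n) a n la *: P_la la x.

End HilbertSpace.

Definition char_Ypq (R : realType) (p q n : nat) (la : diagram n) : R[i] :=
  (in_Ypq p q la)%:R.

(* Main.v *)
(* Identify L^2(S(n)) with the group algebra of S(n).  Every x in S(n+1) is
   y or y (a n+1), a <= n, with y = p_{n,n+1}(x), so L_z^n is, up to a scalar,
   f |-> f (z + X), X being the Jucys-Murphy element.  As X is the difference of
   the sums of transpositions of S(n+1) and S(n), which act on the isotypic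
   components nu and la by the sums of contents, the component nu of L_z^n f, for
   f in H(la), is z + c times that of f, where c is the content of the added
   box.  For z = k = p - q it vanishes when the box has content -k, and adding a
   box moves a diagram in or out of Y(p,q) only if the box has this content.
   Hence L_k^n commutes with the projections onto the H^n_pq, which therefore
   converge to commuting projections A_pq on H.

   Specht modules are replaced by the central idempotents of the Young
   symmetrizers, and dimensions do not occur.  If q is the self-adjoint
   quasi-idempotent of la, then by the double coset decomposition
   S(n+1) = S(n) u S(n) s S(n) the corner q C[S(n+1)] q is spanned by one element
   more than there are removable boxes in la; it contains the nonzero orthogonal
   elements q e_nu, one for each addable box, so that these span it.  This
   yields by induction both the completeness of the Young symmetrizers and the
   branching rule. *)

Require Import Defs.
From HB Require Import structures.
From mathcomp Require Import all_boot all_order all_algebra all_fingroup.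
From mathcomp Require Import mxrepresentation sesquilinear.
From mathcomp Require Import boolp classical_sets reals topology normedtype.
From mathcomp Require Import complex.
From mathcomp Require Import zify ring.

Set Implicit Arguments.
Unset Strict Implicit.
Unset Printing Implicit Defensive.

Import Order.TTheory GRing.Theory Num.Theory.
Import numFieldNormedType.Exports.

Local Open Scope classical_set_scope.
Local Open Scope complex_scope.
Local Open Scope ring_scope.

(** * The group algebra and its primitive elements *)

(** The obstacle is that [Hla] and [transition] are given only implicitly, by intertwining operators
    and by a choice of a ratio. Both become statements about a central idempotent e of the group
    algebra: f lies in H(la) iff f e = f, and the ratio of norms exists because all traces on a
    simple block are proportional. In the induction, completeness for S(n) serves one level further
    up: the transposition of the last two points of S(n+2) commutes with S(n), so the sum of the
    idempotents of S(n), which is 1, can be inserted next to it, and multiplicity one between S(n)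
    and S(n+1) leaves one dimension for each summand. The count closes because a diagram has more
    addable than removable boxes. [galg R[i] 'S_n] and [L2 R n] unfold to the same type, so
    functions pass between the two without a map; the alias only adds convolution. *)

Definition galg (F : numClosedFieldType) (gT : finGroupType) : Type :=
  {ffun gT -> F^o}.

Section GroupAlgebra.
Variables (F : numClosedFieldType) (gT : finGroupType).
Local Notation A := (galg F gT).
Implicit Types (u v w : A) (g h x : gT).

HB.instance Definition _ := Vector.copy A {ffun gT -> F^o}.

Definition gdelta g : A := [ffun h => (h == g)%:R].
Definition gmul u v : A := [ffun x => \sum_g u g * v (g^-1 * x)%g].

Lemma gmulE u v x : gmul u v x = \sum_g u g * v (g^-1 * x)%g.
Proof. by rewrite ffunE. Qed.

Lemma gaddE u v g : (u + v) g = u g + v g.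
Proof. by rewrite ffunE. Qed.

Lemma gscaleE (c : F) u g : (c *: u) g = c * u g.
Proof. by rewrite ffunE. Qed.

Lemma gsumE I (r : seq I) (P : pred I) (f : I -> A) g :
  (\sum_(i <- r | P i) f i) g = \sum_(i <- r | P i) f i g.
Proof. by rewrite sum_ffunE. Qed.

Lemma gdeltaE g h : gdelta g h = (h == g)%:R.
Proof. by rewrite ffunE. Qed.

Fact gmulA : associative gmul.
Proof.
move=> u v w; apply/ffunP=> x; rewrite !gmulE.
under eq_bigr do rewrite gmulE mulr_sumr.
under [RHS]eq_bigr do rewrite gmulE mulr_suml.
rewrite [RHS]exchange_big /=; apply: eq_bigr => g _.
rewrite [RHS](reindex_inj (mulgI g)) /=; apply: eq_bigr => h _.
by rewrite mulKg mulrA invMg mulgA.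
Qed.

Fact gmul1 : left_id (gdelta 1%g) gmul.
Proof.
move=> u; apply/ffunP=> x; rewrite gmulE (bigD1 1%g) //= big1 => [|g /negPf g1].
  by rewrite gdeltaE eqxx mul1r invg1 mul1g addr0.
by rewrite gdeltaE g1 mul0r.
Qed.

Fact g1mul : right_id (gdelta 1%g) gmul.
Proof.
move=> u; apply/ffunP=> x; rewrite gmulE (bigD1 x) //= big1 => [|g g1].
  by rewrite gdeltaE mulVg eqxx mulr1 addr0.
by rewrite gdeltaE -eq_invg_mul invgK (negPf g1) mulr0.
Qed.

Fact gmulDl : left_distributive gmul +%R.
Proof.
move=> u v w; apply/ffunP=> x; rewrite gaddE !gmulE -big_split /=.
by apply: eq_bigr => g _; rewrite gaddE mulrDl.
Qed.

Fact gmulDr : right_distributive gmul +%R.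
Proof.
move=> u v w; apply/ffunP=> x; rewrite gaddE !gmulE -big_split /=.
by apply: eq_bigr => g _; rewrite gaddE mulrDr.
Qed.

Fact gone_neq0 : gdelta 1%g != 0.
Proof.
apply/eqP=> /ffunP/(_ 1%g); rewrite gdeltaE eqxx ffunE.
by apply/eqP; exact: oner_neq0.
Qed.

HB.instance Definition _ :=
  GRing.Zmodule_isNzRing.Build A gmulA gmul1 g1mul gmulDl gmulDr gone_neq0.

Fact gscalerAl (c : F) u v : c *: (u * v) = (c *: u) * v.
Proof.
apply/ffunP=> x; rewrite gscaleE /= !gmulE mulr_sumr.
by apply: eq_bigr => g _; rewrite gscaleE mulrA.
Qed.

HB.instance Definition _ := GRing.Lmodule_isLalgebra.Build F A gscalerAl.

Fact gscalerAr (c : F) u v : c *: (u * v) = u * (c *: v).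
Proof.
apply/ffunP=> x; rewrite gscaleE /= !gmulE mulr_sumr.
by apply: eq_bigr => g _; rewrite gscaleE mulrCA.
Qed.

HB.instance Definition _ := GRing.Lalgebra_isAlgebra.Build F A gscalerAr.

Lemma gmul_coef u v x : (u * v) x = \sum_g u g * v (g^-1 * x)%g.
Proof. exact: gmulE. Qed.

Lemma gdelta1 : gdelta 1%g = 1. Proof. by []. Qed.

Lemma gmul_delta u h x : (u * gdelta h) x = u (x * h^-1)%g.
Proof.
rewrite gmul_coef (bigD1 (x * h^-1)%g) //= big1 => [|g gx].
  by rewrite gdeltaE invMg invgK mulgKV eqxx mulr1 addr0.
rewrite gdeltaE; case: eqP => [E|]; last by rewrite mulr0.
by rewrite -E invMg invgK mulKVg eqxx in gx.
Qed.

Lemma delta_gmul u h x : (gdelta h * u) x = u (h^-1 * x)%g.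
Proof.
rewrite gmul_coef (bigD1 h) //= big1 => [|g /negPf gh].
  by rewrite gdeltaE eqxx mul1r addr0.
by rewrite gdeltaE gh mul0r.
Qed.

Lemma gdeltaM g h : gdelta (g * h)%g = gdelta g * gdelta h.
Proof.
by apply/ffunP=> x; rewrite gmul_delta !gdeltaE (can2_eq (mulgKV h) (mulgK h)).
Qed.

Lemma galg_expand u : u = \sum_g u g *: gdelta g.
Proof.
apply/ffunP=> x; rewrite gsumE (bigD1 x) //= big1 => [|g gx].
  by rewrite gscaleE gdeltaE eqxx mulr1 addr0.
by rewrite gscaleE gdeltaE eq_sym (negPf gx) mulr0.
Qed.

Definition gconj u : A := [ffun x => Num.conj (u x)].
Definition gflip u : A := [ffun x => u x^-1%g].
Definition gstar u : A := gflip (gconj u).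
Definition gtr u : F := u 1%g.

Fact gconj_additive : zmod_morphism gconj.
Proof. by move=> u v; apply/ffunP=> x; rewrite !ffunE rmorphB. Qed.
HB.instance Definition _ := GRing.isZmodMorphism.Build A A gconj gconj_additive.

Fact gflip_linear : linear gflip.
Proof. by move=> c u v; apply/ffunP=> x; rewrite !ffunE. Qed.
HB.instance Definition _ := GRing.isLinear.Build F A A *:%R gflip gflip_linear.

Fact gstar_additive : zmod_morphism gstar.
Proof. by move=> u v; rewrite /gstar !raddfB. Qed.
HB.instance Definition _ := GRing.isZmodMorphism.Build A A gstar gstar_additive.

Fact gtr_linear : scalar gtr.
Proof. by move=> c u v; rewrite /gtr gaddE gscaleE. Qed.
HB.instance Definition _ := GRing.isLinear.Build F A F *%R gtr gtr_linear.

Lemma gconjM u v : gconj (u * v) = gconj u * gconj v.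
Proof.
apply/ffunP=> x; rewrite ffunE !gmul_coef rmorph_sum.
by apply: eq_bigr => g _; rewrite rmorphM !ffunE.
Qed.

Lemma gconjZ c u : gconj (c *: u) = Num.conj c *: gconj u.
Proof. by apply/ffunP=> x; rewrite [LHS]ffunE !gscaleE rmorphM [in RHS]ffunE. Qed.

Lemma gconj_delta g : gconj (gdelta g) = gdelta g.
Proof. by apply/ffunP=> x; rewrite !ffunE rmorph_nat. Qed.

Lemma gflipM u v : gflip (u * v) = gflip v * gflip u.
Proof.
apply/ffunP=> x; rewrite ffunE !gmul_coef.
rewrite (reindex_inj (mulgI x^-1%g)) /=.
by apply: eq_bigr => g _; rewrite !ffunE !invMg !invgK mulgK mulrC.
Qed.

Lemma gflip_delta g : gflip (gdelta g) = gdelta g^-1%g.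
Proof. by apply/ffunP=> x; rewrite !ffunE (can2_eq invgK invgK). Qed.

Lemma gflipK : involutive gflip.
Proof. by move=> u; apply/ffunP=> x; rewrite !ffunE invgK. Qed.

Lemma gstarM u v : gstar (u * v) = gstar v * gstar u.
Proof. by rewrite /gstar gconjM gflipM. Qed.

Lemma gstarZ c u : gstar (c *: u) = Num.conj c *: gstar u.
Proof. by rewrite /gstar gconjZ linearZ. Qed.

Lemma gstar_delta g : gstar (gdelta g) = gdelta g^-1%g.
Proof. by rewrite /gstar gconj_delta gflip_delta. Qed.

Lemma gstarE u g : gstar u g = Num.conj (u g^-1%g).
Proof. by rewrite !ffunE. Qed.

Lemma gstarK : involutive gstar.
Proof. by move=> u; apply/ffunP=> x; rewrite !gstarE invgK conjCK. Qed.

Lemma gtrC u v : gtr (u * v) = gtr (v * u).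
Proof.
rewrite /gtr !gmul_coef (reindex_inj invg_inj) /=.
by apply: eq_bigr => g _; rewrite invgK !mulg1 mulrC.
Qed.

Lemma gtr_mulstar u v : gtr (u * gstar v) = \sum_g u g * Num.conj (v g).
Proof.
rewrite /gtr gmul_coef; apply: eq_bigr => g _.
by rewrite gstarE mulg1 invgK.
Qed.

Lemma gtr_norm_ge0 u : 0 <= gtr (u * gstar u).
Proof. by rewrite gtr_mulstar sumr_ge0 // => g _; rewrite -normCK exprn_ge0. Qed.

Lemma gtr_norm_eq0 u : (gtr (u * gstar u) == 0) = (u == 0).
Proof.
apply/eqP/eqP=> [|->]; last by rewrite mul0r linear0.
rewrite gtr_mulstar => /eqP; rewrite psumr_eq0 => [/allP u0|g _]; last first.
  by rewrite -normCK exprn_ge0.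
apply/ffunP=> g; rewrite ffunE; apply/eqP; have := u0 g (mem_index_enum g).
by rewrite -normCK sqrf_eq0 normr_eq0.
Qed.

Lemma mulstar_neq0 u : u != 0 -> u * gstar u != 0.
Proof. by apply: contraNneq => E; rewrite -gtr_norm_eq0 E linear0. Qed.

Lemma gtr_norm_gt0 u : u != 0 -> 0 < gtr (u * gstar u).
Proof. by rewrite lt_def gtr_norm_ge0 gtr_norm_eq0 andbT. Qed.

Lemma gcentral_ext u : (forall g, gdelta g * u = u * gdelta g) ->
  forall v, v * u = u * v.
Proof.
move=> uC v; rewrite [v]galg_expand mulr_suml mulr_sumr.
by apply: eq_bigr => g _; rewrite -scalerAl -scalerAr uC.
Qed.

Definition primitive y : Prop :=
  y != 0 /\ forall u, exists c : F, y * u * y = c *: y.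

(** Unlike [y] it is self-adjoint. For primitive [y] it is a positive multiple of an idempotent and
    generates the same right ideal as [y] ([gsq_recover]). *)
Definition gsq y : A := locked (y * gstar y).
Lemma gsqE y : gsq y = y * gstar y. Proof. by rewrite /gsq -lock. Qed.

Lemma gstar_sq y : gstar (gsq y) = gsq y.
Proof. by rewrite gsqE gstarM gstarK. Qed.

(* [kappa y] and [central_scale y] are the scalars by which [y * gstar y] and
   [central_sum y] act on a primitive [y]. *)
Definition kappa y : F := locked (gtr (gsq y * gsq y) / gtr (gsq y)).
Definition central_sum y : A := \sum_g gdelta g^-1%g * gsq y * gdelta g.
Definition central_scale y : F :=
  locked (gtr (central_sum y * gsq y) / gtr (gsq y)).
(** For primitive [y], summing the conjugates of the rank one element [gsq y] yields a central
    element, and the rescaling makes it the identity of the simple block containing [y]. *)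
Definition cidem y : A := (central_scale y)^-1 *: central_sum y.

Lemma central_sumC y v : v * central_sum y = central_sum y * v.
Proof.
apply: gcentral_ext => h; rewrite /central_sum mulr_sumr mulr_suml.
rewrite (reindex_inj (mulIg h)) /=; apply: eq_bigr => g _.
by rewrite invMg !gdeltaM !mulrA -gdeltaM mulgV gdelta1 mul1r.
Qed.

Lemma cidemC y v : v * cidem y = cidem y * v.
Proof. by rewrite -scalerAr central_sumC scalerAl. Qed.

Section Primitive.
Variable y : A.
Hypothesis prim_y : primitive y.

Lemma gsq_neq0 : gsq y != 0.
Proof. by rewrite gsqE mulstar_neq0 //; case: prim_y. Qed.

Lemma gtr_sq_gt0 : 0 < gtr (gsq y).
Proof. by rewrite gsqE gtr_norm_gt0 //; case: prim_y. Qed.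

Lemma kappa_gt0 : 0 < kappa y.
Proof.
rewrite /kappa -lock divr_gt0 ?gtr_sq_gt0 // -{2}gstar_sq.
by rewrite gtr_norm_gt0 ?gsq_neq0.
Qed.

Lemma kappa_neq0 : kappa y != 0. Proof. by rewrite gt_eqF ?kappa_gt0. Qed.

Lemma gsq_mul : gsq y * y = kappa y *: y.
Proof.
have [c E] := prim_y.2 (gstar y); rewrite /kappa -lock.
suff -> : gsq y * gsq y = c *: gsq y.
  by rewrite linearZ /= mulfK ?gt_eqF ?gtr_sq_gt0 // gsqE E.
by rewrite {2}gsqE mulrA gsqE E -scalerAl.
Qed.

Lemma gsq_idem : gsq y * gsq y = kappa y *: gsq y.
Proof. by rewrite {2}gsqE mulrA gsq_mul -scalerAl -gsqE. Qed.

Lemma gsq_corner u : exists c : F, gsq y * u * gsq y = c *: gsq y.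
Proof.
have [c E] := prim_y.2 (gstar y * u); exists c.
by rewrite !gsqE !mulrA -(mulrA y (gstar y) u) E -scalerAl.
Qed.

(** With q = [gsq y] and q g q = f(g) q, self-adjointness of q gives q (g^-1 q g) q = |f(g)|^2 q.
    The scale is thus a positive multiple of a sum of squares whose term at g = 1 is the square of
    [kappa y]. *)
Lemma central_sum_sq :
  central_scale y != 0 /\ central_sum y * gsq y = central_scale y *: gsq y.
Proof.
suff [c c0 E] : exists2 c, 0 < c & central_sum y * gsq y = c *: gsq y.
  have -> : central_scale y = c.
    by rewrite /central_scale -lock E linearZ /= mulfK // gt_eqF ?gtr_sq_gt0.
  by split=> //; rewrite gt_eqF.
pose q := gsq y; have qK : q = (kappa y)^-1 *: (q * q).
  by rewrite gsq_idem scalerA mulVf ?scale1r ?kappa_neq0.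
have qs : gstar q = q by exact: gstar_sq.
have [f fE] := choice (fun g => gsq_corner (gdelta g)); rewrite -/q in fE.
have f1 : f 1%g = kappa y.
  apply/eqP; rewrite -subr_eq0; have := fE 1%g.
  rewrite gdelta1 mulr1 gsq_idem => /eqP; rewrite eq_sym -subr_eq0 -scalerBl.
  by rewrite scaler_eq0 (negPf gsq_neq0) orbF.
exists ((kappa y)^-1 * \sum_g `|f g| ^+ 2).
  rewrite mulr_gt0 ?invr_gt0 ?kappa_gt0 // (bigD1 1%g) //= f1.
  rewrite ltr_pwDl ?exprn_gt0 ?normr_gt0 ?kappa_neq0 //.
  by rewrite sumr_ge0 // => g _; rewrite exprn_ge0.
rewrite -/q {1}qK -scalerAr mulrA -central_sumC -scalerA; congr (_ *: _).
rewrite /central_sum mulr_sumr mulr_suml scaler_suml; apply: eq_bigr => g _.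
rewrite -/q.
have -> : q * (gdelta g^-1%g * q * gdelta g) * q =
          gstar (q * gdelta g * q) * gdelta g * q.
by rewrite (gstarM (q * gdelta g)) (gstarM q) qs gstar_delta !mulrA.
rewrite fE gstarZ qs -!scalerAl fE scalerA.
by rewrite normCK mulrC.
Qed.

Lemma central_scale_neq0 : central_scale y != 0.
Proof. by case: central_sum_sq. Qed.

Lemma cidem_sq : cidem y * gsq y = gsq y.
Proof.
have [c0 E] := central_sum_sq.
by rewrite -scalerAl E scalerA mulVf ?scale1r.
Qed.

Lemma gsq_recover : y = (kappa y)^-1 *: (gsq y * y).
Proof. by rewrite gsq_mul scalerA mulVf ?scale1r ?kappa_neq0. Qed.

Lemma cidem_mul : cidem y * y = y.
Proof.
by rewrite {2}gsq_recover -scalerAr mulrA cidem_sq -gsq_recover.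
Qed.

Lemma mul_cidem : y * cidem y = y.
Proof. by rewrite cidemC cidem_mul. Qed.

Lemma cidem_expand : cidem y =
  \sum_g (central_scale y)^-1 *: (gdelta g^-1%g * gsq y * gdelta g).
Proof. by rewrite /cidem -scaler_sumr. Qed.

(* [cidem y] belongs to the two-sided ideal of [y]. *)
Lemma cidem_absorb u : (forall v, u * v = v * u) -> u * y = y ->
  u * cidem y = cidem y.
Proof.
move=> uC uy; rewrite cidem_expand mulr_sumr; apply: eq_bigr => g _.
have uq : u * gsq y = gsq y by rewrite gsqE mulrA uy.
by rewrite -scalerAr !mulrA uC -(mulrA _ u) uq.
Qed.

Lemma cidem_idem : cidem y * cidem y = cidem y.
Proof. by apply: cidem_absorb => [v|]; rewrite ?cidemC ?cidem_mul. Qed.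

Lemma cidem_neq0 : cidem y != 0.
Proof. by apply: contraNneq prim_y.1 => E; rewrite -cidem_mul E mul0r. Qed.

Lemma gstar_cidem : gstar (cidem y) = cidem y.
Proof.
have zE : gstar (central_sum y) = central_sum y.
  rewrite raddf_sum; apply: eq_bigr => g _ /=.
  by rewrite gstarM (gstarM (gdelta _)) gstar_sq !gstar_delta invgK mulrA.
have sE : gstar (cidem y) =
    (Num.conj (central_scale y)^-1 * central_scale y) *: cidem y.
  by rewrite /cidem gstarZ zE scalerA mulfK ?central_scale_neq0.
(* The adjoint is a multiple of [cidem y], hence absorbed by it. The left side is self-adjoint, so
   one more adjoint identifies the two. *)
have E : gstar (cidem y) * cidem y = gstar (cidem y).
  by rewrite sE -scalerAl cidem_idem.
by rewrite -E -[RHS]gstarK -[in RHS]E gstarM gstarK.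
Qed.

Section Tracial.
Variables (f : A -> F).
Hypothesis (fC : forall u v, f (u * v) = f (v * u)) (f_lin : scalar f).

(* Traces on a simple algebra are proportional. *)
Lemma tracial_proportional u : u * cidem y = u ->
  f u * gtr (gsq y) = gtr u * f (gsq y).
Proof.
move=> ue; pose fl : {scalar A} := HB.pack f (GRing.isLinear.Build F A F *%R f f_lin).
rewrite -[f]/(fl : A -> F).
have flC v w : fl (v * w) = fl (w * v) by exact: fC.
clearbody fl; rewrite -ue cidem_expand mulr_sumr !linear_sum !mulr_suml /=.
apply: eq_bigr => g _; rewrite -!scalerAr !linearZ /= -!mulrA; congr (_ * _).
have [c E] := gsq_corner (gdelta g * u * gdelta g^-1%g).
(* The scalar [c] depends on [u] and [g] but not on the trace [h]; using the formula for both [fl]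
   and [gtr] gives the proportionality. *)
have main (h : {scalar A}) : (forall v w, h (v * w) = h (w * v)) ->
    h (u * (gdelta g^-1%g * (gsq y * gdelta g))) = (kappa y)^-1 * (c * h (gsq y)).
  move=> hC; apply: (mulfI (kappa_neq0)); rewrite mulVKf ?kappa_neq0 //.
  have -> : c * h (gsq y) = h (gsq y * (gdelta g * u * gdelta g^-1%g) * gsq y).
    by rewrite E linearZ.
  have -> : kappa y * h (u * (gdelta g^-1%g * (gsq y * gdelta g))) =
      h ((u * gdelta g^-1%g * gsq y) * (gsq y * gdelta g)).
    by rewrite -!mulrA (mulrA (gsq y) (gsq y)) gsq_idem -scalerAl -!scalerAr linearZ.
  by rewrite hC !mulrA.
by rewrite !main //; [rewrite -!mulrA (mulrC (fl _))|apply: gtrC].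
Qed.
End Tracial.
End Primitive.

Lemma cidem_eq y1 y2 : primitive y1 -> primitive y2 ->
  cidem y1 * y2 = y2 -> cidem y2 * y1 = y1 -> cidem y1 = cidem y2.
Proof.
move=> p1 p2 E12 E21; rewrite -(cidem_absorb _ E21) => [|//]; last first.
  by move=> v; rewrite cidemC.
rewrite -cidemC (cidem_absorb _ E12) // => v; by rewrite cidemC.
Qed.

Lemma cidem_orth y1 y2 : (forall u, y1 * u * y2 = 0) -> cidem y1 * cidem y2 = 0.
Proof.
move=> O; rewrite !cidem_expand mulr_suml big1 // => g _.
rewrite mulr_sumr big1 // => h _; rewrite -scalerAl -scalerAr.
have -> : gdelta g^-1%g * gsq y1 * gdelta g * (gdelta h^-1%g * gsq y2 * gdelta h) =
  gdelta g^-1%g * (y1 * (gstar y1 * gdelta g * gdelta h^-1%g) * y2) * gstar y2 * gdelta h.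
  by rewrite !gsqE !mulrA.
by rewrite O mulr0 !mul0r !scaler0.
Qed.

Lemma cidem_conjugate y1 y2 g h : primitive y1 -> primitive y2 ->
  y2 = gdelta g * y1 * gdelta h -> cidem y1 = cidem y2.
Proof.
move=> p1 p2 E; apply: cidem_eq => //.
  by rewrite E !mulrA -cidemC -(mulrA _ (cidem _)) cidem_mul.
have -> : y1 = gdelta g^-1%g * y2 * gdelta h^-1%g.
  by rewrite E !mulrA -gdeltaM mulVg -mulrA -gdeltaM mulgV gdelta1 mulr1 mul1r.
by rewrite !mulrA -cidemC -(mulrA _ (cidem _)) cidem_mul.
Qed.

End GroupAlgebra.

(** * Diagrams, tableaux and Young symmetrizers *)

Section DiagramFacts.
Variable n : nat.
Implicit Types (la : diagram n) (t : 'I_n -> nat * nat).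

Lemma size_row_lengths la : size (row_lengths la) = n.
Proof. by rewrite size_map size_tuple. Qed.

Lemma row_length_noninc la i j : (i <= j)%N ->
  (row_length la j <= row_length la i)%N.
Proof.
case/andP: (valP la) => srt _ ij; rewrite /row_length.
have [jn|nj] := ltnP j n; last first.
  by rewrite (nth_default _ (s := row_lengths la)) ?size_row_lengths.
have geq_tr : transitive geq by move=> a b c /= ba cb; apply: leq_trans cb ba.
have geq_rf : reflexive geq by move=> a /=.
apply: (sorted_leq_nth geq_tr geq_rf 0%N srt) => //.
  by rewrite inE size_row_lengths (leq_ltn_trans ij).
by rewrite inE size_row_lengths.
Qed.

Lemma sum_row_lengths la : sumn (row_lengths la) = n.
Proof. by case/andP: (valP la) => _ /eqP. Qed.

Lemma row_length_big la r : (n <= r)%N -> row_length la r = 0%N.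
Proof. by move=> nr; rewrite /row_length nth_default // size_row_lengths. Qed.

Lemma diagram_ext la mu : row_length la =1 row_length mu -> la = mu.
Proof.
move=> E; apply/val_inj/val_inj/(inj_map val_inj).
apply: (@eq_from_nth _ 0%N); first by rewrite !size_row_lengths.
by move=> i _; apply: E.
Qed.

Lemma col_length_exists la :
  exists m : nat -> nat, forall r c, (c < row_length la r)%N = (r < m c)%N.
Proof.
have ex c : exists r, (row_length la r <= c)%N by exists n; rewrite row_length_big.
exists (fun c => ex_minn (ex c)) => r c; case: ex_minnP => m mc min.
apply/idP/idP => h; rewrite ltnNge; apply: contraL h; rewrite -leqNgt.
  by move=> /(row_length_noninc la) mr; rewrite (leq_trans mr).
exact: min.
Qed.

Lemma row_length_le la r : (row_length la r <= n)%N.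
Proof.
have [rn|] := ltnP r n; last by move/(row_length_big la) ->.
by rewrite /row_length /row_lengths (nth_map ord0) ?size_tuple // -ltnS ltn_ord.
Qed.

(* Entries of a Young tableau are the elements of 'I_n, [t i] being the cell
   (row, column), numbered from 0, that contains [i]. *)
Definition tableau la t : Prop :=
  injective t /\ forall r c, (c < row_length la r)%N <-> exists i, t i = (r, c).

Lemma tableau_cell la t i : tableau la t -> ((t i).2 < row_length la (t i).1)%N.
Proof. by case=> _ /(_ (t i).1 (t i).2) -> ; exists i; case: (t i). Qed.

Lemma tableau_perm la t (s : 'S_n) : tableau la t -> tableau la (t \o s).
Proof.
case=> tI tP; split=> [|r c]; first exact: inj_comp tI perm_inj.
rewrite tP; split=> [[i ti]|[i ti]]; last by exists (s i).
by exists (s^-1 i)%g; rewrite /= permKV.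
Qed.

Lemma standard_tableau la : tableau la (fun i => (tab_row la i, tab_col la i)).
Proof.
split=> [i j [rij cij]|r c].
  apply/val_inj; rewrite /= -(reshape_indexK (row_lengths la) i).
  by rewrite -(reshape_indexK (row_lengths la) j) [reshape_index _ _]rij [reshape_offset _ _]cij.
split=> [cr|[i [<- <-]]].
  have ltn := flatten_indexP cr; rewrite sum_row_lengths in ltn.
  exists (Ordinal ltn); rewrite /tab_row /tab_col /=.
  by rewrite flatten_indexKl ?flatten_indexKr.
by apply: reshape_offsetP; rewrite sum_row_lengths.
Qed.

Lemma card_tableau_row la t r : tableau la t ->
  #|[pred i | (t i).1 == r]| = row_length la r.
Proof.
case=> tI tP; have /choice [f fP] : forall c : 'I_(row_length la r), exists i, t i = (r, val c).
  by move=> c; apply/tP/ltn_ord.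
rewrite -[RHS]card_ord -(card_imset (f := f)) => [|c d E].
  apply: eq_card => i; rewrite !inE; apply/eqP/imsetP => [ti|[c _ ->]]; last first.
    by rewrite fP.
  have cr : ((t i).2 < row_length la r)%N by rewrite -ti (tableau_cell _ (conj tI tP)).
  by exists (Ordinal cr) => //; apply: tI; rewrite fP /= -ti; case: (t i).
by apply: val_inj; have := fP c; rewrite E fP => -[].
Qed.

Lemma tableau_shape_inj la mu t t' (s : 'S_n) : tableau la t -> tableau mu t' ->
  (forall i, (t' (s i)).1 = (t i).1) -> la = mu.
Proof.
move=> tt tt' E; apply: diagram_ext => r.
rewrite -(card_tableau_row r tt) -(card_tableau_row r (tableau_perm s tt')).
by apply: eq_card => i; rewrite !inE /= E.
Qed.

Lemma tableau_conj la t t' : tableau la t -> tableau la t' ->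
  exists s : 'S_n, forall i, t' (s i) = t i.
Proof.
move=> [tI tP] [tI' tP'].
have /choice [f fP] i : exists k, t' k = t i.
  by rewrite [t i]surjective_pairing; apply/tP'/(tableau_cell _ (conj tI tP)).
have fI : injective f by move=> i j E; apply: tI; rewrite -!fP E.
by exists (perm fI) => i; rewrite permE.
Qed.

(* The cells of a diagram are the pairs where the weight (row) - (length of the
   column) is negative, hence they minimise its sum over sets of pairs. *)
Lemma cells_minimize mu t (d : 'I_n -> nat * nat) : tableau mu t ->
  injective d -> (forall i, (d i).2 = (t i).2) ->
  (\sum_i (t i).1 <= \sum_i (d i).1)%N /\
  ((\sum_i (t i).1 = \sum_i (d i).1)%N -> exists s : 'S_n, forall i, t (s i) = d i).
Proof.
move=> tt dI d2; case: (tt) => tI tP; have [m mP] := col_length_exists mu.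
pose W (x : nat * nat) : int := x.1%:R - (m x.2)%:R.
pose sD := codom d; pose sT := codom t.
have W_lt0 x : x \in sT -> W x < 0.
  by case/codomP=> i ->; rewrite subr_lt0 ltr_nat -mP tableau_cell.
have W_ge0 x : x \notin sT -> 0 <= W x.
  move=> xT; rewrite subr_ge0 ler_nat leqNgt -mP; apply: contra xT => xc.
  by have [i E] := (tP _ _).1 xc; apply/codomP; exists i; rewrite E -surjective_pairing.
have uD : uniq sD by rewrite map_inj_uniq ?enum_uniq.
have uT : uniq sT by rewrite map_inj_uniq ?enum_uniq.
have sumD : \sum_(x <- sD) W x = (\sum_i (d i).1)%:R - \sum_i (m (t i).2)%:R.
  rewrite big_map big_enum /= sumrB -natr_sum; congr (_ - _).
  by apply: eq_bigr => i _; rewrite d2.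
have sumT : \sum_(x <- sT) W x = (\sum_i (t i).1)%:R - \sum_i (m (t i).2)%:R.
  by rewrite big_map big_enum /= sumrB -natr_sum.
have common : \sum_(x <- sD | x \in sT) W x = \sum_(x <- sT | x \in sD) W x.
  rewrite -big_filter -[RHS]big_filter; apply: perm_big; apply: uniq_perm.
  - exact: filter_uniq.
  - exact: filter_uniq.
  by move=> x; rewrite !mem_filter andbC.
have leD : \sum_(x <- sD | x \in sT) W x <= \sum_(x <- sD) W x.
  rewrite [leRHS](bigID (mem sT)) /= lerDl sumr_ge0 // => x; exact: W_ge0.
have splitT : \sum_(x <- sT) W x =
    \sum_(x <- sT | x \in sD) W x + \sum_(x <- sT | x \notin sD) W x.
  by rewrite [LHS](bigID (mem sD)).
have leT : \sum_(x <- sT | x \notin sD) W x <= 0.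
  rewrite big_seq_cond sumr_le0 // => x /andP[xT _]; exact/ltW/W_lt0.
split=> [|E].
  rewrite -(ler_nat int) -(lerD2r (- \sum_i (m (t i).2)%:R)) -sumD -sumT splitT.
  by rewrite -common (le_trans _ leD) // gerDl.
(* In case of equality a cell missed by [d] would contribute a strictly negative weight, so [d] hits
   every cell. *)
have subT x : x \in sT -> x \in sD.
  move=> xT; apply/negPn/negP => xD.
  have: 0 <= \sum_(y <- sT | y \notin sD) W y.
    by move: leD; rewrite sumD -E -sumT splitT common lerDl.
  rewrite leNgt -big_filter (bigD1_seq x) ?filter_uniq ?mem_filter ?xD //=.
  rewrite ltr_wnDr ?W_lt0 // big_seq_cond sumr_le0 // => y.
  by rewrite mem_filter => /andP[/andP[_ yT] _]; exact/ltW/W_lt0.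
have sDT : sD =i sT.
  by move=> x; have [|_ ->] := uniq_min_size uT subT; rewrite ?size_map.
have /choice [f fP] i : exists k, t k = d i.
  have : d i \in sT by rewrite -sDT codom_f.
  by case/codomP=> k ->; exists k.
have fI : injective f by move=> i j ij; apply: dI; rewrite -!fP ij.
by exists (perm fI) => i; rewrite permE.
Qed.
End DiagramFacts.

(** * Row sums, column sums and Young symmetrizers *)

Section Symmetrizers.
Variables (F : numClosedFieldType) (n : nat).
Local Notation A := (galg F 'S_n).
Implicit Types (f : 'I_n -> nat) (t : 'I_n -> nat * nat) (u : A) (s g h : 'S_n).

(** One notion for both groups of a tableau: on the two components of [std la] it is convertible to
    [row_stab la] and [col_stab la]. *)
Definition fiber_stab f : {set 'S_n} := [set s : 'S_n | [forall m, f (s m) == f m]].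

Lemma fiber_stabP f s : reflect (forall m, f (s m) = f m) (s \in fiber_stab f).
Proof. by rewrite inE; apply: (iffP forallP) => H m; apply/eqP/H. Qed.

Lemma fiber_stab1 f : 1%g \in fiber_stab f.
Proof. by apply/fiber_stabP => m; rewrite perm1. Qed.

Lemma fiber_stabM f s g : s \in fiber_stab f ->
  ((s * g)%g \in fiber_stab f) = (g \in fiber_stab f).
Proof.
move/fiber_stabP=> fs; apply/fiber_stabP/fiber_stabP => H m.
  by have := H (s^-1 m)%g; rewrite permM permKV -[in f m](permKV s m) fs.
by rewrite permM H fs.
Qed.

Lemma fiber_stabV f s : (s^-1%g \in fiber_stab f) = (s \in fiber_stab f).
Proof.
wlog: s / s \in fiber_stab f => [W|sf].
  apply/idP/idP => h; last by rewrite W.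
  by rewrite -(invgK s) W.
by rewrite sf -(fiber_stabM _ sf) mulgV fiber_stab1.
Qed.

Lemma fiber_stabMr f s g : g \in fiber_stab f ->
  ((s * g)%g \in fiber_stab f) = (s \in fiber_stab f).
Proof. by move=> gf; rewrite -(fiber_stabV f (s * g)) invMg fiber_stabM fiber_stabV. Qed.

Lemma fiber_stab_tperm f i k : (tperm i k \in fiber_stab f) = (f i == f k).
Proof.
apply/fiber_stabP/eqP => [/(_ k)|E m]; first by rewrite tpermR.
by case: tpermP => [->|->|].
Qed.

Definition row_sum t : A :=
  locked (\sum_(h in fiber_stab (fst \o t)) gdelta F h).
Definition col_sum t : A :=
  locked (\sum_(v in fiber_stab (snd \o t)) (-1) ^+ odd_perm v *: gdelta F v).

Lemma row_sumE t : row_sum t = \sum_(h in fiber_stab (fst \o t)) gdelta F h.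
Proof. by rewrite /row_sum -lock. Qed.

Lemma col_sumE t : col_sum t =
  \sum_(v in fiber_stab (snd \o t)) (-1) ^+ odd_perm v *: gdelta F v.
Proof. by rewrite /col_sum -lock. Qed.

Definition young t : A := locked (row_sum t * col_sum t).

Lemma youngE t : young t = row_sum t * col_sum t.
Proof. by rewrite /young -lock. Qed.

Lemma row_sum_delta t h : h \in fiber_stab (fst \o t) ->
  row_sum t * gdelta F h = row_sum t.
Proof.
move=> hR; rewrite row_sumE mulr_suml [RHS](reindex_inj (mulIg h)) /=.
by apply: eq_big => g; rewrite ?fiber_stabMr // -gdeltaM.
Qed.

Lemma delta_row_sum t h : h \in fiber_stab (fst \o t) ->
  gdelta F h * row_sum t = row_sum t.
Proof.
move=> hR; rewrite row_sumE mulr_sumr [RHS](reindex_inj (mulgI h)) /=.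
by apply: eq_big => g; rewrite ?fiber_stabM // -gdeltaM.
Qed.

Lemma col_sum_delta t v : v \in fiber_stab (snd \o t) ->
  col_sum t * gdelta F v = (-1) ^+ odd_perm v *: col_sum t.
Proof.
move=> vC; rewrite col_sumE mulr_suml [in RHS](reindex_inj (mulIg v)) /= scaler_sumr.
apply: eq_big => g; rewrite ?fiber_stabMr // -scalerAl -gdeltaM scalerA => _.
by rewrite odd_permM signr_addb mulrC -mulrA -expr2 sqrr_sign mulr1.
Qed.

Lemma delta_col_sum t v : v \in fiber_stab (snd \o t) ->
  gdelta F v * col_sum t = (-1) ^+ odd_perm v *: col_sum t.
Proof.
move=> vC; rewrite col_sumE mulr_sumr [in RHS](reindex_inj (mulgI v)) /= scaler_sumr.
apply: eq_big => g; rewrite ?fiber_stabM // -scalerAr -gdeltaM scalerA => _.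
by rewrite odd_permM signr_addb mulrA -expr2 sqrr_sign mul1r.
Qed.

Lemma gstar_row_sum t : gstar (row_sum t) = row_sum t.
Proof.
rewrite row_sumE raddf_sum [RHS](reindex_inj invg_inj) /=.
by apply: eq_big => g; rewrite ?fiber_stabV // gstar_delta.
Qed.

Lemma gstar_col_sum t : gstar (col_sum t) = col_sum t.
Proof.
rewrite col_sumE raddf_sum [RHS](reindex_inj invg_inj) /=.
apply: eq_big => g; rewrite ?fiber_stabV // gstarZ gstar_delta odd_permV => _.
by rewrite rmorphXn rmorphN1.
Qed.

Lemma gconj_young t : gconj (young t) = young t.
Proof.
rewrite youngE gconjM row_sumE col_sumE !raddf_sum /=; congr (_ * _).
  by apply: eq_bigr => g _; rewrite gconj_delta.
by apply: eq_bigr => g _; rewrite gconjZ gconj_delta rmorphXn rmorphN1.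
Qed.

Lemma row_sum_1 t : row_sum t 1%g = 1.
Proof.
rewrite row_sumE gsumE (bigD1 1%g) ?fiber_stab1 //= gdeltaE eqxx big1 ?addr0 // => g.
by rewrite gdeltaE eq_sym => /andP[_ /negPf ->].
Qed.

(** The row and column stabilizers of an injective [t] meet only in the identity. *)
Lemma gtr_young t : injective t -> gtr (young t) = 1.
Proof.
move=> tI; rewrite youngE /gtr gmul_coef.
rewrite (bigD1 1%g) //= row_sum_1 mul1r invg1 mul1g big1 => [|g g1].
  rewrite col_sumE gsumE (bigD1 1%g) ?fiber_stab1 //= gscaleE gdeltaE eqxx odd_perm1.
  rewrite expr0 mulr1 big1 ?addr0 // => g /andP[_ /negPf g1].
  by rewrite gscaleE gdeltaE eq_sym g1 mulr0.
rewrite row_sumE col_sumE !gsumE; have [gR|gR] := boolP (g \in fiber_stab (fst \o t)).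
  rewrite [X in _ * X]big1 ?mulr0 // => v vC; rewrite gscaleE gdeltaE mulg1.
  case: eqP => [E|]; last by rewrite mulr0.
  case/eqP: g1; apply/permP => i; rewrite perm1; apply: tI.
  move: vC; rewrite -E fiber_stabV => /fiber_stabP/(_ i) /= c.
  by move/fiber_stabP/(_ i): gR => /= r; rewrite [LHS]surjective_pairing r c -surjective_pairing.
rewrite big1 ?mul0r // => h hR; rewrite gdeltaE; case: eqP => // E.
by rewrite E hR in gR.
Qed.

Lemma young_neq0 t : injective t -> young t != 0.
Proof.
move/gtr_young => y1; apply/eqP => y0; move: y1; rewrite y0 linear0 => /eqP.
by rewrite eq_sym oner_eq0.
Qed.

(** The transposition of [i] and [k] is absorbed by the row sum; carried across [s] it is absorbed
    by the column sum with sign -1. *)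
Lemma row_col_collision t t' s i k : i != k -> (t i).1 = (t k).1 ->
  (t' (s i)).2 = (t' (s k)).2 -> row_sum t * gdelta F s * col_sum t' = 0.
Proof.
move=> ik Er Ec; set w := _ * col_sum t'.
suff ww : w = - w.
  have : 2%:R *: w == 0 by rewrite scaler_nat mulr2n {1}ww addNr.
  by rewrite scaler_eq0 pnatr_eq0 => /eqP.
rewrite {1}/w -(@row_sum_delta t (tperm i k)) ?fiber_stab_tperm /= ?Er //.
rewrite -(mulrA (row_sum t)) -gdeltaM.
have -> : (tperm i k * s = s * tperm (s i) (s k))%g by rewrite -tpermJ conjgE mulKVg.
rewrite gdeltaM mulrA -(mulrA (row_sum t * _)) delta_col_sum ?fiber_stab_tperm /= ?Ec //.
by rewrite odd_tperm (inj_eq perm_inj) ik expr1 scaleN1r mulrN.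
Qed.

(** Without a collision, taking the row from [t] and the column from [t'] is injective, and
    [cells_minimize] applies. The sum of the row indices plays the part of the dominance order on
    shapes. *)
Lemma row_col_cases t la t' mu s : tableau la t -> tableau mu t' ->
  row_sum t * gdelta F s * col_sum t' = 0 \/
  [/\ (\sum_i (t' i).1 <= \sum_i (t i).1)%N
    & (\sum_i (t' i).1 = \sum_i (t i).1)%N ->
      exists x : 'S_n, forall i, t' (s (x i)) = ((t i).1, (t' (s i)).2)].
Proof.
move=> tt tt'; pose d i := ((t i).1, (t' (s i)).2).
have [/injectiveP dI|/injectivePn[i [k ik [Er Ec]]]] := boolP (injectiveb d); last first.
  by left; apply: row_col_collision ik _ _.
right; have tts := tableau_perm s tt'.
have <- : (\sum_i (t' (s i)).1 = \sum_i (t' i).1)%N.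
  by rewrite [RHS](reindex_inj (@perm_inj _ s)).
exact: (cells_minimize tts dI).
Qed.

(** Von Neumann's lemma: unless the product vanishes, [s] factors into a row permutation and a
    column permutation, which the two sums absorb up to sign. *)
Lemma young_corner t la s : tableau la t ->
  exists c : F, row_sum t * gdelta F s * col_sum t = c *: young t.
Proof.
move=> tt; have [->|[_ /(_ erefl)[x xP]]] := row_col_cases s tt tt.
  by exists 0; rewrite scale0r.
pose r := (x * s)%g; pose v := (s^-1 * r)%g.
have rR : r \in fiber_stab (fst \o t).
  by apply/fiber_stabP => i /=; rewrite permM xP.
have vC : v \in fiber_stab (snd \o t).
  apply/fiber_stabP => i /=; rewrite !permM xP /= permKV //.
have -> : s = (r * v^-1)%g by rewrite /v invMg invgK mulKVg.
exists ((-1) ^+ odd_perm v^-1); rewrite gdeltaM mulrA row_sum_delta //.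
by rewrite -mulrA delta_col_sum ?fiber_stabV // -scalerAr youngE.
Qed.

Lemma young_primitive t la : tableau la t -> primitive (young t).
Proof.
move=> tt; split; first by apply: young_neq0; case: tt.
move=> u; set w := col_sum t * u * row_sum t.
have -> : young t * u * young t = row_sum t * w * col_sum t by rewrite youngE !mulrA.
have /choice [f fP] s := young_corner s tt.
exists (\sum_s w s * f s); rewrite [in LHS](galg_expand w) mulr_sumr mulr_suml scaler_suml.
by apply: eq_bigr => s _; rewrite -scalerAr -scalerAl fP scalerA.
Qed.

Lemma row_col_vanish t t' : (forall s, row_sum t * gdelta F s * col_sum t' = 0) ->
  forall u, row_sum t * u * col_sum t' = 0.
Proof.
move=> H u; rewrite [u]galg_expand mulr_sumr mulr_suml big1 // => s _.
by rewrite -scalerAr -scalerAl H scaler0.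
Qed.

(** The sums of row indices decide which of the two mixed products of a row sum and a column sum
    vanishes; both occur inside the product, one of them up to the adjoint. *)
Lemma young_orth t la t' mu u : tableau la t -> tableau mu t' -> la <> mu ->
  young t * u * young t' = 0.
Proof.
move=> tt tt' ne.
have [le|lt] := leqP (\sum_i (t' i).1) (\sum_i (t i).1).
  have vanish : forall w, row_sum t' * w * col_sum t = 0.
    apply: row_col_vanish => s; have [//|[le' eq']] := row_col_cases s tt' tt.
    have /eq' [x xP] : (\sum_i (t i).1 = \sum_i (t' i).1)%N.
      by apply/eqP; rewrite eqn_leq le' le.
    case: ne; apply/esym.
    apply: (@tableau_shape_inj _ mu la t' t (x * s)%g) => // i.
    by rewrite permM xP.
  (* The adjoint turns this vanishing into that of [col_sum t * u * row_sum t'], the middle of the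
     product. *)
  have := vanish (gstar u); move/(congr1 (@gstar _ _)).
  rewrite raddf0 !gstarM gstarK gstar_row_sum gstar_col_sum => E.
  have -> : young t * u * young t' =
    row_sum t * (col_sum t * (u * row_sum t')) * col_sum t' by rewrite !youngE !mulrA.
  by rewrite E mulr0 mul0r.
have vanish : forall w, row_sum t * w * col_sum t' = 0.
  apply: row_col_vanish => s; have [//|[le' _]] := row_col_cases s tt tt'.
  by rewrite leqNgt lt in le'.
have -> : young t * u * young t' =
  row_sum t * (col_sum t * u * row_sum t') * col_sum t' by rewrite !youngE !mulrA.
exact: vanish.
Qed.
End Symmetrizers.

Section Idempotents.
Variables (F : numClosedFieldType) (n : nat).
Local Notation A := (galg F 'S_n).
Implicit Types (la mu : diagram n) (t : 'I_n -> nat * nat) (u : A) (s g h : 'S_n).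

Lemma young_conj t t' s : (forall i, t' (s i) = t i) ->
  young F t' = gdelta F s^-1%g * young F t * gdelta F s.
Proof.
move=> tE; have st (f f' : 'I_n -> nat) : (forall i, f' (s i) = f i) ->
    forall h, ((s^-1 * h * s)%g \in fiber_stab f') = (h \in fiber_stab f).
  move=> fE h; apply/fiber_stabP/fiber_stabP => H i.
    by have := H (s i); rewrite !permM permK !fE.
  by rewrite !permM fE H -fE permKV.
have injc : injective (fun h => (s^-1 * h * s)%g).
  by apply: inj_comp (mulIg s) (mulgI s^-1%g).
have tE1 i : (fst \o t') (s i) = (fst \o t) i by rewrite /= tE.
have tE2 i : (snd \o t') (s i) = (snd \o t) i by rewrite /= tE.
have rE : row_sum F t' = gdelta F s^-1%g * row_sum F t * gdelta F s.
  rewrite !row_sumE (reindex_inj injc) /= mulr_sumr mulr_suml.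
  by apply: eq_big => h; rewrite ?(st _ _ tE1) // !gdeltaM.
have cE : col_sum F t' = gdelta F s^-1%g * col_sum F t * gdelta F s.
  rewrite !col_sumE (reindex_inj injc) /= mulr_sumr mulr_suml.
  apply: eq_big => h; rewrite ?(st _ _ tE2) // !gdeltaM => _.
  by rewrite -scalerAr -scalerAl !odd_permM odd_permV addbAC addbb.
rewrite !youngE rE cE !mulrA; congr (_ * _ * _).
by rewrite -(mulrA _ (gdelta F s)) -gdeltaM mulgV gdelta1 mulr1.
Qed.

Definition std la : 'I_n -> nat * nat := fun i => (tab_row la i, tab_col la i).

Lemma std_tableau la : tableau la (std la).
Proof. exact: standard_tableau. Qed.

Definition didem la : A := cidem (young F (std la)).

Lemma prim_std la : primitive (young F (std la)).
Proof. exact: young_primitive (std_tableau la). Qed.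

Lemma didem_tableau la t : tableau la t -> cidem (young F t) = didem la.
Proof.
move=> tt; have [s sE] := tableau_conj tt (std_tableau la).
by apply: cidem_conjugate (young_conj sE); apply: young_primitive; eauto using std_tableau.
Qed.

Lemma didemC la u : u * didem la = didem la * u.
Proof. exact: cidemC. Qed.

Lemma didem_orth la mu : la != mu -> didem la * didem mu = 0.
Proof.
move=> /eqP ne; apply: cidem_orth => u.
exact: young_orth (std_tableau la) (std_tableau mu) ne.
Qed.

Lemma didem_idem la : didem la * didem la = didem la.
Proof. exact/cidem_idem/prim_std. Qed.

Lemma gstar_didem la : gstar (didem la) = didem la.
Proof. exact/gstar_cidem/prim_std. Qed.

(** Twice the class sum of the transpositions plus n times the identity. Summing over all ordered
    pairs keeps the recursions [tsum_rec] and [theta_ext] free of order conditions. *)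
Definition tsum : A := \sum_(i < n) \sum_(k < n) gdelta F (tperm i k).

Lemma tsumC u : u * tsum = tsum * u.
Proof.
apply: gcentral_ext => g; rewrite /tsum mulr_sumr mulr_suml.
rewrite [LHS](reindex_inj (@perm_inj _ g)) /=; apply: eq_bigr => i _.
rewrite mulr_sumr mulr_suml [LHS](reindex_inj (@perm_inj _ g)) /=; apply: eq_bigr => k _.
by rewrite -!gdeltaM -tpermJ conjgE mulKVg.
Qed.

(* The terms [i = k] cancel in the two sums over rows and columns, while
   [tperm i i] is the identity. *)
Definition theta t : F := \sum_(i < n) \sum_(k < n)
  ((i == k)%:R + ((t i).1 == (t k).1)%:R - ((t i).2 == (t k).2)%:R).

Lemma tsum_young la t : tableau la t -> tsum * young F t = theta t *: young F t.
Proof.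
move=> tt; case: (tt) => tI tP.
rewrite youngE mulrA -tsumC mulr_sumr mulr_suml scaler_suml; apply: eq_bigr => i _.
rewrite mulr_sumr mulr_suml scaler_suml; apply: eq_bigr => k _.
have [->|ik] := eqVneq i k; first by rewrite !eqxx tperm1 gdelta1 mulr1 addrK scale1r.
rewrite add0r; have [er|nr] := eqVneq (t i).1 (t k).1.
  have /negPf -> : (t i).2 != (t k).2.
    apply: contra ik => /eqP ec; apply/eqP/tI.
    by rewrite [LHS]surjective_pairing er ec -surjective_pairing.
  by rewrite subr0 scale1r row_sum_delta // fiber_stab_tperm /= er.
have [ec|nc] := eqVneq (t i).2 (t k).2.
  rewrite sub0r scaleN1r -mulrA delta_col_sum ?fiber_stab_tperm /= ?ec //.
  by rewrite odd_tperm ik scaleN1r mulrN.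
rewrite subr0 scale0r.
wlog lt : i k ik nr nc / ((t i).1 < (t k).1)%N => [W|].
  have [lt|] := ltnP (t i).1 (t k).1; first exact: W.
  by rewrite leq_eqVlt eq_sym (negPf nr) tpermC => /W; apply; rewrite eq_sym.
(* The cell in the row of [i] and the column of [k] belongs to the diagram, the row of [i] being the
   upper one. Its entry [m] shares the row of [i] and, once [tperm i k] has moved [i] to [k], the
   column as well. *)
have /tP[m tm] : ((t k).2 < row_length la (t i).1)%N.
  by rewrite (leq_trans (tableau_cell k tt)) // row_length_noninc // ltnW.
have mi : i != m by apply: contraNneq nc => ->; rewrite tm.
have mk : k != m by apply: contraNneq nr => ->; rewrite tm.
apply: (@row_col_collision F n t t _ i m mi); first by rewrite tm.
by rewrite tpermL tpermD // tm.
Qed.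

Lemma mul_didem_tableau la t : tableau la t -> young F t * didem la = young F t.
Proof. by move=> tt; rewrite -(didem_tableau tt) mul_cidem //; apply: young_primitive tt. Qed.

Lemma tsum_didem la t u : tableau la t -> u * didem la = u ->
  tsum * u = theta t *: u.
Proof.
move=> tt <-; rewrite -(didem_tableau tt) cidem_expand !mulr_sumr scaler_sumr.
have K : tsum * gsq (young F t) = theta t *: gsq (young F t).
  by rewrite gsqE mulrA (tsum_young tt) -scalerAl.
apply: eq_bigr => g _; rewrite -!scalerAr scalerA mulrC -scalerA; congr (_ *: _).
rewrite !mulrA -tsumC -(mulrA u) -tsumC mulrA -(mulrA _ tsum) K.
by rewrite -scalerAr -scalerAl.
Qed.
End Idempotents.

(** * The branching rule *)

Section Embedding.
Variables (F : numClosedFieldType) (n : nat).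
Local Notation A := (galg F 'S_n).
Local Notation B := (galg F 'S_n.+1).
Implicit Types (u v : A) (g h : 'S_n).

Definition sincl g : 'S_n.+1 := lift_perm ord_max ord_max g.

Lemma sinclM g h : sincl (g * h)%g = (sincl g * sincl h)%g.
Proof. by rewrite /sincl lift_permM. Qed.

Lemma sincl1 : sincl 1%g = 1%g. Proof. exact: lift_perm1. Qed.

Lemma sinclV g : sincl g^-1%g = (sincl g)^-1%g. Proof. by rewrite /sincl lift_permV. Qed.

Lemma sincl_inj : injective sincl.
Proof.
move=> g h /permP E; apply/permP => i; apply: (@lift_inj _ ord_max).
by have := E (lift ord_max i); rewrite !lift_perm_lift.
Qed.

Definition emb u : B := locked (\sum_g u g *: gdelta F (sincl g)).

Lemma embE u : emb u = \sum_g u g *: gdelta F (sincl g).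
Proof. by rewrite /emb -lock. Qed.

Fact emb_linear : linear emb.
Proof.
move=> c u v; rewrite !embE scaler_sumr -big_split /=; apply: eq_bigr => g _.
by rewrite gaddE gscaleE scalerDl scalerA.
Qed.
HB.instance Definition _ := GRing.isLinear.Build F A B *:%R emb emb_linear.

Lemma emb_delta g : emb (gdelta F g) = gdelta F (sincl g).
Proof.
rewrite embE (bigD1 g) //= gdeltaE eqxx scale1r big1 ?addr0 // => h /negPf hg.
by rewrite gdeltaE hg scale0r.
Qed.

Fact emb_monoid : monoid_morphism emb.
Proof.
split=> [|u v]; first by rewrite -gdelta1 emb_delta sincl1.
rewrite (embE u) mulr_suml [in LHS](galg_expand u) mulr_suml linear_sum /=.
apply: eq_bigr => g _; rewrite -!scalerAl linearZ /=; congr (_ *: _).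
rewrite (embE v) mulr_sumr [in LHS](galg_expand v) mulr_sumr linear_sum /=.
apply: eq_bigr => h _; rewrite -!scalerAr linearZ /=; congr (_ *: _).
by rewrite -gdeltaM emb_delta sinclM gdeltaM.
Qed.
HB.instance Definition _ := GRing.isMonoidMorphism.Build A B emb emb_monoid.

Lemma emb_star u : emb (gstar u) = gstar (emb u).
Proof.
rewrite !embE raddf_sum (reindex_inj invg_inj) /=; apply: eq_bigr => g _.
by rewrite gstarZ gstarE invgK gstar_delta sinclV.
Qed.

Lemma emb_coef u x : emb u x = \sum_(g | sincl g == x) u g.
Proof.
rewrite embE gsumE [RHS]big_mkcond; apply: eq_bigr => g _.
by rewrite gscaleE gdeltaE eq_sym; case: eqP; rewrite ?mulr1 ?mulr0.
Qed.

Lemma emb_sincl u g : emb u (sincl g) = u g.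
Proof.
rewrite emb_coef (eq_bigl (pred1 g)) ?big_pred1_eq // => h.
by rewrite (inj_eq sincl_inj).
Qed.

Lemma emb_out u (x : 'S_n.+1) : x ord_max != ord_max -> emb u x = 0.
Proof.
move=> xm; rewrite emb_coef big1 // => g /eqP E.
by rewrite -E lift_perm_id eqxx in xm.
Qed.

Definition jucys_murphy : B :=
  \sum_(a < n) gdelta F (tperm (lift ord_max a) ord_max).

Lemma sum_ord_max (V : zmodType) (f : 'I_n.+1 -> V) :
  \sum_(i < n.+1) f i = \sum_(i < n) f (lift ord_max i) + f ord_max.
Proof.
rewrite big_ord_recr; congr (_ + _); apply: eq_bigr => i _; congr f.
by apply: val_inj; rewrite /= /bump leqNgt ltn_ord.
Qed.

Lemma sincl_tperm i k : sincl (tperm i k) = tperm (lift ord_max i) (lift ord_max k).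
Proof.
apply/permP => m; case: (unliftP ord_max m) => [a ->|->].
  rewrite lift_perm_lift; case: (tpermP i k a) => [->|->|/eqP ai /eqP ak].
  - by rewrite tpermL.
  - by rewrite tpermR.
  by rewrite tpermD // (inj_eq (@lift_inj _ _)) eq_sym.
by rewrite lift_perm_id tpermD // eq_sym neq_lift.
Qed.

Lemma tsum_rec : tsum F n.+1 = emb (tsum F n) + 2%:R *: jucys_murphy + 1.
Proof.
rewrite /tsum sum_ord_max sum_ord_max tperm1 gdelta1 addrA; congr (_ + _).
under eq_bigr do rewrite sum_ord_max.
rewrite big_split /= -addrA; congr (_ + _).
  rewrite linear_sum; apply: eq_bigr => i _; rewrite linear_sum; apply: eq_bigr => k _.
  by rewrite /= emb_delta sincl_tperm.
rewrite scaler_nat mulr2n /jucys_murphy; congr (_ + _).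
by apply: eq_bigr => i _; rewrite tpermC.
Qed.
End Embedding.

Section Extension.
Variables (F : numClosedFieldType) (n : nat).
Implicit Types (la : diagram n) (nu : diagram n.+1) (t : 'I_n -> nat * nat).

Lemma adds_boxP la nu : reflect
  (exists2 r, (r <= n)%N & forall j, row_length nu j = (row_length la j + (j == r))%N)
  (adds_box la nu).
Proof.
apply: (iffP existsP) => [[i /forallP H]|[r rn H]].
  exists i => [|j]; first by rewrite -ltnS.
  have [jn|nj] := ltnP j n.+1; first by have /eqP := H (Ordinal jn).
  rewrite !row_length_big ?(ltnW nj) // add0n; case: eqP => // ji.
  by move: nj; rewrite ji leqNgt ltn_ord.
by exists (inord r); apply/forallP => j; rewrite H -val_eqE /= inordK.
Qed.

Definition ext_tab t (x : nat * nat) : 'I_n.+1 -> nat * nat :=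
  fun i => if unlift ord_max i is Some j then t j else x.

Lemma ext_tab_lift t x i : ext_tab t x (lift ord_max i) = t i.
Proof. by rewrite /ext_tab liftK. Qed.

Lemma ext_tab_max t x : ext_tab t x ord_max = x.
Proof. by rewrite /ext_tab unlift_none. Qed.

Section AddBox.
Variables (la : diagram n) (nu : diagram n.+1) (t : 'I_n -> nat * nat) (r0 : nat).
Hypothesis tt : tableau la t.
Hypothesis nuE : forall j, row_length nu j = (row_length la j + (j == r0))%N.
Let c0 := row_length la r0.
Let t' := ext_tab t (r0, c0).

Lemma ext_tableau : tableau nu t'.
Proof.
case: (tt) => tI tP; split=> [i k|r c].
  have out j : t j <> (r0, c0).
    by move=> E; have := tableau_cell j tt; rewrite E /= /c0 ltnn.
  rewrite /t'; case: (unliftP ord_max i) => [a ->|->];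
    case: (unliftP ord_max k) => [b ->|->]; rewrite ?ext_tab_lift ?ext_tab_max //.
  - by move/tI ->.
  - by move/out.
  by move/esym/out.
rewrite nuE; split=> [|ex].
  have [->|rr] := eqVneq r r0; last first.
    by rewrite addn0 => /tP[i ti]; exists (lift ord_max i); rewrite /t' ext_tab_lift.
  rewrite addn1 ltnS leq_eqVlt => /orP[/eqP ->|/tP[i ti]].
    by exists ord_max; rewrite /t' ext_tab_max.
  by exists (lift ord_max i); rewrite /t' ext_tab_lift.
case: ex => i; rewrite /t'; case: (unliftP ord_max i) => [a ->|->];
  rewrite ?ext_tab_lift ?ext_tab_max.
  by move=> ta; apply: ltn_addr; apply/tP; exists a.
by case=> <- <-; rewrite eqxx addn1 /c0.
Qed.

Lemma card_addable_col : #|[pred i | (t i).2 == c0]| = r0.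
Proof.
case: (tt) => tI tP.
have above r : (r < r0)%N -> (c0 < row_length la r)%N.
  move=> rr; have := row_length_noninc nu (ltnW rr).
  by rewrite !nuE eqxx (ltn_eqF rr) addn0 addn1.
have /choice [f fP] : forall r : 'I_r0, exists i, t i = (val r, c0).
  by move=> r; apply/tP/above/ltn_ord.
rewrite -[RHS]card_ord -(card_imset (f := f)) => [|c d E].
  apply: eq_card => i; rewrite !inE; apply/eqP/imsetP => [ti|[c _ ->]]; last first.
    by rewrite fP.
  have rr : ((t i).1 < r0)%N.
    rewrite ltnNge; apply/negP => /(row_length_noninc la); rewrite leqNgt.
    by rewrite -/c0 -ti (tableau_cell i tt).
  by exists (Ordinal rr) => //; apply: tI; rewrite fP /= -ti -surjective_pairing.
by apply: val_inj; have := fP c; rewrite E fP => -[].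
Qed.

(** The new box has c0 old boxes in its row and r0 in its column, and each pair is counted in both
    orders. *)
Lemma theta_ext : theta F t' = theta F t + 2%:R * (c0%:R - r0%:R) + 1.
Proof.
rewrite /theta sum_ord_max sum_ord_max !eqxx addrK addrA; congr (_ + _).
under eq_bigr do rewrite sum_ord_max.
rewrite big_split /= -addrA; congr (_ + _).
  apply: eq_bigr => i _; apply: eq_bigr => k _.
  by rewrite /t' !ext_tab_lift (inj_eq (@lift_inj _ _)).
have sumE : \sum_(i < n) (((t i).1 == r0)%:R - ((t i).2 == c0)%:R) = c0%:R - r0%:R :> F.
  rewrite sumrB -!natr_sum; congr (_%:R - _%:R).
    by rewrite /c0 -(card_tableau_row r0 tt) -sum1_card [RHS]big_mkcond.
  by rewrite -[RHS]card_addable_col -sum1_card [RHS]big_mkcond.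
rewrite mulr2n mulrDl mul1r -sumE; congr (_ + _); apply: eq_bigr => i _;
  rewrite /t' ext_tab_lift ext_tab_max /=.
  by rewrite eq_sym (negPf (neq_lift _ _)) add0r.
by rewrite (negPf (neq_lift _ _)) add0r eq_sym (eq_sym c0).
Qed.

(* Its coefficient at the identity is the product of the orders of the row and
   column stabilizers of [t]. *)
Lemma young_restriction_neq0 : young F t' * emb (gstar (young F t)) != 0.
Proof.
have st (f : 'I_n -> nat) (f' : 'I_n.+1 -> nat) :
    (forall i, f' (lift ord_max i) = f i) ->
    forall h, h \in fiber_stab f -> sincl h \in fiber_stab f'.
  move=> fE h /fiber_stabP H; apply/fiber_stabP => i.
  case: (unliftP ord_max i) => [a ->|->]; last by rewrite lift_perm_id.
  by rewrite lift_perm_lift !fE H.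
have st1 h : h \in fiber_stab (fst \o t) -> sincl h \in fiber_stab (fst \o t').
  by apply: st => i; rewrite /= /t' ext_tab_lift.
have st2 h : h \in fiber_stab (snd \o t) -> sincl h \in fiber_stab (snd \o t').
  by apply: st => i; rewrite /= /t' ext_tab_lift.
have colE : col_sum F t' * emb (col_sum F t) = #|fiber_stab (snd \o t)|%:R *: col_sum F t'.
  rewrite (col_sumE F t) linear_sum mulr_sumr scaler_nat -sumr_const; apply: eq_bigr => v vC.
  rewrite /= linearZ /= emb_delta -scalerAr col_sum_delta ?st2 // scalerA.
  by rewrite /sincl odd_lift_perm addbb -expr2 sqrr_sign scale1r.
have rowE : emb (row_sum F t) * row_sum F t' = #|fiber_stab (fst \o t)|%:R *: row_sum F t'.
  rewrite (row_sumE F t) linear_sum mulr_suml scaler_nat -sumr_const; apply: eq_bigr => v vC.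
  by rewrite /= emb_delta delta_row_sum ?st1.
apply/eqP => /(congr1 (@gtr _ _)); rewrite linear0 (youngE F t) gstarM gstar_row_sum gstar_col_sum.
rewrite rmorphM youngE mulrA -(mulrA (row_sum F t')) colE gtrC -scalerAr -scalerAr.
rewrite mulrA rowE -scalerAl scalerA linearZ /= -youngE gtr_young; last by case: ext_tableau.
have cn (f : 'I_n -> nat) : #|fiber_stab f|%:R != 0 :> F.
  by rewrite pnatr_eq0 -lt0n; apply/card_gt0P; exists 1%g; apply: fiber_stab1.
by rewrite mulr1 => /eqP; apply/negP; rewrite mulf_neq0 ?cn.
Qed.
End AddBox.

Lemma didem_restriction_neq0 la nu : adds_box la nu -> emb (didem F la) * didem F nu != 0.
Proof.
case/adds_boxP => r _ nuE; have tt := std_tableau la; have tt' := ext_tableau tt nuE.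
have ne := young_restriction_neq0 tt nuE.
apply/eqP => E; case/eqP: ne.
rewrite -{1}(mul_didem_tableau F tt') -{1}(@cidem_mul _ _ _ (prim_std F la)) -/(didem F la).
rewrite gstarM gstar_didem rmorphM -mulrA (mulrA (didem F nu)).
by rewrite -(didemC nu) -mulrA -(didemC nu) E !mulr0.
Qed.
End Extension.

Section Projection.
Variable n : nat.
Implicit Types (x : 'S_n.+1) (g : 'S_n).

Lemma projection_split x :
  x = (sincl (canonical_projection x) * tperm (x ord_max) ord_max)%g.
Proof.
have neq i : x ord_max != x (lift ord_max i) by rewrite (inj_eq perm_inj) neq_lift.
apply/permP => m; rewrite permM; case: (unliftP ord_max m) => [i ->|->]; last first.
  by rewrite /sincl lift_perm_id tpermR.
rewrite /sincl lift_perm_lift [canonical_projection x i]permE /canonical_projection_fun.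
case: (unliftP ord_max (x (lift ord_max i))) => [a Ea|Ea] /=.
  by rewrite Ea tpermD //; [rewrite -Ea|rewrite neq_lift].
case: (unliftP ord_max (x ord_max)) => [a Eb|Eb] /=; first by rewrite Eb tpermL.
by have := neq i; rewrite Ea Eb eqxx.
Qed.

End Projection.

(** * Construction of diagrams and the count of addable boxes *)

Section DiagramConstruction.

Lemma diagram_exists n (f : nat -> nat) : (forall i, f i.+1 <= f i)%N ->
  (forall i, (n <= i)%N -> f i = 0%N) -> (\sum_(i < n) f i = n)%N ->
  exists la : diagram n, row_length la =1 f.
Proof.
move=> fmon f0 fsum.
have fn i : (f i <= n)%N.
  have [ni|ni] := ltnP i n; last by rewrite f0.
  by rewrite -[leqRHS]fsum (bigD1 (Ordinal ni)) //= leq_addr.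
pose T : n.-tuple 'I_n.+1 := [tuple inord (f i) | i < n].
have TE : map val T = mkseq f n.
  rewrite /= -map_comp /mkseq -val_enum_ord -map_comp; apply: eq_map => i /=.
  by rewrite inordK // ltnS.
have ok : sorted geq (map val T) && (sumn (map val T) == n).
  rewrite TE; apply/andP; split; last first.
    by rewrite sumnE big_map -[X in _ == X]fsum -(big_mkord xpredT f) /index_iota subn0.
  apply/(sortedP 0%N) => i; rewrite size_mkseq => ni.
  by rewrite !nth_mkseq //= ltnW.
exists (Diagram ok) => r; rewrite /row_length /row_lengths /= TE.
have [rn|nr] := ltnP r n; first by rewrite nth_mkseq.
by rewrite f0 // nth_default // size_mkseq.
Qed.

Lemma sum_row_length n (la : diagram n) : (\sum_(i < n) row_length la i = n)%N.
Proof.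
rewrite -[RHS](sum_row_lengths la) sumnE (big_nth 0%N) size_row_lengths big_mkord.
by apply: eq_bigr.
Qed.

Lemma addable_exists n (la : diagram n) r : (r <= n)%N ->
  (r = 0 \/ row_length la r < row_length la r.-1)%N ->
  exists nu : diagram n.+1, forall j, row_length nu j = (row_length la j + (j == r))%N.
Proof.
move=> rn ok; apply: diagram_exists => [i|i ni|].
- have := row_length_noninc la (leqnSn i).
  case: (eqVneq i.+1 r) ok => [<- [//|/=]|_ _]; last lia.
  by rewrite ltn_eqF //; lia.
- have ri : (r < i)%N by apply: leq_ltn_trans ni.
  by rewrite row_length_big 1?ltnW // eq_sym (ltn_eqF ri).
rewrite big_split /= big_ord_recr /= sum_row_length row_length_big // addn0.
rewrite (bigD1 (Ordinal (rn : (r < n.+1)%N))) //= eqxx big1 ?addn1 // => i.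
by rewrite -val_eqE /= => /negPf ->.
Qed.

(* A box can be removed from row r iff one can be added to row r+1, and a box can
   always be added to row 0. *)
Lemma card_addable n (nu : diagram n.+1) :
  (#|[pred la : diagram n | adds_box la nu]| < #|[pred mu | adds_box nu mu]|)%N.
Proof.
pose P (la : diagram n) (mu : diagram n.+2) r :=
  (forall j, row_length nu j = (row_length la j + (j == r))%N) /\
  (forall j, row_length mu j = (row_length nu j + (j == r.+1))%N).
have ex (la : diagram n) : exists mu, adds_box la nu -> exists r, P la mu r.
  have [/adds_boxP[r rn H]|_] := boolP (adds_box la nu); last first.
    by have [//|mu _] := @addable_exists _ nu 0 _ (or_introl erefl); exists mu.
  have [||mu muE] := @addable_exists _ nu r.+1; [by []| |by exists mu => _; exists r].
  by right; rewrite /= !H eqxx gtn_eqF // addn0 addn1 ltnS row_length_noninc.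
have [f fP] := choice ex.
have [//|mu0 mu0E] := @addable_exists _ nu 0 _ (or_introl erefl).
have rowsI (r r' : nat) (mu : diagram n.+2) :
    (forall j, row_length mu j = row_length nu j + (j == r))%N ->
    (forall j, row_length mu j = row_length nu j + (j == r'))%N -> r = r'.
  by move=> H H'; have := H r; rewrite H' eqxx; case: eqP => // _; lia.
pose R := [set la : diagram n | adds_box la nu]%SET.
have fI : {in R &, injective f}.
  move=> la la'; rewrite !inE => /fP[r [H1 H2]] /fP[r' [H1' H2']] E.
  have [rr] : r.+1 = r'.+1 by apply: rowsI H2 _; rewrite E.
  by apply: diagram_ext => j; apply/(@addIn (j == r)); rewrite -H1 [in RHS]rr -H1'.
have <- : #|R| = #|[pred la : diagram n | adds_box la nu]|.
  by apply: eq_card => la; rewrite !inE.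
rewrite -(card_in_imset fI).
have mu0N : mu0 \notin (f @: R)%SET.
  apply/imsetP => -[la]; rewrite inE => /fP[r [_ H]] E.
  by rewrite -E in H; have := rowsI 0%N r.+1 mu0 mu0E H.
have -> : #|(f @: R)%SET|.+1 = #|(mu0 |: f @: R)%SET| by rewrite cardsU1 mu0N.
apply/subset_leq_card/fintype.subsetP => mu; rewrite !inE => /orP[/eqP ->|/imsetP[la]].
  by apply/adds_boxP; exists 0%N.
rewrite inE => lanu ->; have [r [H1 H2]] := fP la lanu.
apply/adds_boxP; exists r.+1 => //; rewrite ltnS.
case/adds_boxP: lanu => r' rn' H'; suff -> : r = r' by [].
have := H1 r; rewrite H' eqxx; case: eqP => // _; lia.
Qed.
End DiagramConstruction.

Section Branching.
Variable F : numClosedFieldType.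
Local Notation A n := (galg F 'S_n).

Definition dsq n (la : diagram n) : A n := gsq (young F (std la)).

Lemma dsq_idem n (la : diagram n) :
  dsq la * dsq la = kappa (young F (std la)) *: dsq la.
Proof. exact/gsq_idem/prim_std. Qed.

Lemma kappa_std_neq0 n (la : diagram n) : kappa (young F (std la)) != 0.
Proof. exact/kappa_neq0/prim_std. Qed.

Lemma didem_dsq n (la : diagram n) : didem F la * dsq la = dsq la.
Proof. exact/cidem_sq/prim_std. Qed.

Lemma gstar_dsq n (la : diagram n) : gstar (dsq la) = dsq la.
Proof. exact: gstar_sq. Qed.

Lemma dsq_corner n (la : diagram n) u : exists c : F, dsq la * u * dsq la = c *: dsq la.
Proof. exact/gsq_corner/prim_std. Qed.

(** The square is kept so that one factor [dsq la] can go to each side of another element, as in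
    [corner_span]. *)
Lemma didem_sq_expand n (la : diagram n) : exists c : F, didem F la =
  \sum_g c *: (gdelta F g^-1%g * (dsq la * dsq la) * gdelta F g).
Proof.
rewrite /didem cidem_expand; set k := (_)^-1.
exists (k / kappa (young F (std la))); apply: eq_bigr => g _.
by rewrite dsq_idem -scalerAr -scalerAl scalerA divfK ?kappa_std_neq0.
Qed.

Definition complete n := \sum_(la : diagram n) didem F la = 1.

(** The branching rule read off the corner Q C[S(n+1)] Q, with Q = [emb (dsq la)]: only addable
    diagrams occur in Q, and each component of the corner has dimension at most one. *)
Definition branches n := forall la : diagram n,
  emb (dsq la) * \sum_(nu | adds_box la nu) didem F nu = emb (dsq la) /\
  forall x nu, exists c : F,
    emb (dsq la) * x * emb (dsq la) * didem F nu = c *: (emb (dsq la) * didem F nu).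

Lemma emb_didem_split n (la : diagram n) : branches n ->
  emb (didem F la) = \sum_(nu | adds_box la nu) emb (didem F la) * didem F nu.
Proof.
move=> /(_ la)[br _]; have [c cE] := didem_sq_expand la.
rewrite -mulr_sumr [in RHS]cE [in LHS]cE !linear_sum mulr_suml; apply: eq_bigr => g _ /=.
rewrite !linearZ /= -scalerAl; congr (_ *: _); rewrite !rmorphM.
set S := \sum_(_ | _) _.
have SC u : S * u = u * S.
  by rewrite /S mulr_suml mulr_sumr; apply: eq_bigr => nu _; rewrite didemC.
by rewrite -[RHS]mulrA -SC !mulrA -(mulrA _ _ S) br.
Qed.

Lemma emb_didem_orth n (la : diagram n) nu : branches n -> ~~ adds_box la nu ->
  emb (didem F la) * didem F nu = 0.
Proof.
move=> br lanu; rewrite (emb_didem_split la br) mulr_suml big1 // => mu lamu.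
rewrite -mulrA didem_orth ?mulr0 //.
by apply: contraTneq lamu => ->.
Qed.

Lemma complete_step n : complete n -> branches n -> complete n.+1.
Proof.
move=> cn br; rewrite /complete; set S := \sum_nu _.
have S1 : 1 = \sum_(la : diagram n) \sum_(nu | adds_box la nu) emb (didem F la) * didem F nu.
  rewrite -[LHS](rmorph1 (@emb F n)) -cn rmorph_sum; apply: eq_bigr => la _.
  exact: emb_didem_split.
rewrite -[LHS]mul1r {1}S1 mulr_suml [RHS]S1; apply: eq_bigr => la _.
rewrite mulr_suml; apply: eq_bigr => nu _; rewrite -mulrA; congr (_ * _).
rewrite /S mulr_sumr (bigD1 nu) //= didem_idem big1 ?addr0 // => mu ne.
by rewrite didem_orth // eq_sym.
Qed.

Lemma branches_of_span n (la : diagram n) (X : seq (A n.+1)) :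
  (size X <= #|[pred nu | adds_box la nu]|)%N ->
  (forall x, emb (dsq la) * x * emb (dsq la) \in <<X>>%VS) ->
  emb (dsq la) * \sum_(nu | adds_box la nu) didem F nu = emb (dsq la) /\
  forall x nu, exists c : F,
    emb (dsq la) * x * emb (dsq la) * didem F nu = c *: (emb (dsq la) * didem F nu).
Proof.
set Q := emb (dsq la); set K := kappa (young F (std la)) => szX spX.
have QQ : Q * Q = K *: Q by rewrite -rmorphM dsq_idem /= linearZ.
have K0 : K != 0 := kappa_std_neq0 la.
pose s := enum [pred nu | adds_box la nu].
pose Z := [tuple Q * didem F (tnth (in_tuple s) i) | i < size s].
have sadd i : adds_box la (tnth (in_tuple s) i).
  by have := mem_tnth i (in_tuple s); rewrite mem_enum.
have sI i j : (tnth (in_tuple s) i == tnth (in_tuple s) j) = (i == j).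
  exact/inj_eq/tuple_uniqP/enum_uniq.
have Zdidem (i : 'I_(size s)) nu : Z`_i * didem F nu =
    (tnth (in_tuple s) i == nu)%:R *: (Q * didem F nu).
  rewrite -tnth_nth tnth_mktuple -mulrA; case: eqVneq => [->|ne].
    by rewrite didem_idem scale1r.
  by rewrite didem_orth // mulr0 scale0r.
have Q_neq0 i : Q * didem F (tnth (in_tuple s) i) != 0.
  apply: contra_neq (didem_restriction_neq0 F (sadd i)) => E.
  (* [emb (didem F la)] lies in the two-sided ideal of [Q], so it would be killed together with
     [Q]. *)
  have [c cE] := didem_sq_expand la; rewrite cE linear_sum mulr_suml big1 // => g _.
  rewrite /= linearZ /= -scalerAl !rmorphM /= -(mulrA _ (emb (gdelta F g))) didemC.
  by rewrite !mulrA -(mulrA _ Q) E mulr0 mul0r scaler0.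
have freeZ : free Z.
  apply/freeP => k k0 i; have := congr1 (fun v => v * didem F (tnth (in_tuple s) i)) k0.
  rewrite mul0r mulr_suml (bigD1 i) //= -scalerAl Zdidem eqxx scale1r big1 ?addr0 => [/eqP|j ji].
    by rewrite scaler_eq0 (negPf (Q_neq0 i)) orbF => /eqP.
  by rewrite -scalerAl Zdidem sI (negPf ji) scale0r scaler0.
have ZX : (<<Z>> <= <<X>>)%VS.
  apply/span_subvP => z /tnthP[i ->]; rewrite tnth_mktuple.
  (* Centrality of the idempotent puts its product with [Q] into the corner. *)
  have -> : Q * didem F (tnth (in_tuple s) i) = K^-1 *: (Q * didem F (tnth (in_tuple s) i) * Q).
    by rewrite -mulrA -didemC mulrA QQ -scalerAl scalerA mulVf ?scale1r.
  exact/memvZ/spX.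
have ZXe : (<<Z>> = <<X>>)%VS.
  apply/eqP; rewrite eqEdim ZX (eqP freeZ) size_tuple (leq_trans (dim_span X)) //.
  by rewrite /s -cardE.
have dec x nu : exists c : F, Q * x * Q * didem F nu = c *: (Q * didem F nu).
  have := spX x; rewrite -ZXe => /coord_span ->; rewrite mulr_suml.
  eexists; rewrite -[RHS]scale1r scalerA.
  under eq_bigr do rewrite -scalerAl Zdidem scalerA.
  by rewrite -scaler_suml mul1r.
split=> //; have: Q * 1 * Q \in <<Z>>%VS by rewrite ZXe.
rewrite mulr1 QQ => /(memvZ K^-1); rewrite scalerA mulVf // scale1r => /coord_span E.
rewrite {1}E [RHS]E mulr_suml; apply: eq_bigr => i _.
rewrite -scalerAl; congr (_ *: _); rewrite -[in RHS]tnth_nth tnth_mktuple mulr_sumr.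
rewrite (bigD1 (tnth (in_tuple s) i)) ?sadd // Zdidem eqxx scale1r.
rewrite big1 => [|nu /andP[_ ne]]; first by rewrite /= addr0.
by rewrite Zdidem eq_sym (negPf ne) scale0r.
Qed.

(* That is, the branching from S(n+1) to S(n) is multiplicity free. *)
Lemma corner_rank1 n (la : diagram n) (nu : diagram n.+1) : branches n ->
  exists w : A n.+1,
    [/\ forall x, exists c : F, dsq nu * x * emb (dsq la) = c *: w
      & ~~ adds_box la nu -> w = 0].
Proof.
move=> br; set q := dsq nu; set Q := emb (dsq la).
have QK : Q * Q = kappa (young F (std la)) *: Q.
  by rewrite -rmorphM dsq_idem /= linearZ.
have Qs : gstar Q = Q by rewrite -emb_star gstar_dsq.
have qs : gstar q = q := gstar_dsq nu.
have qe : q * didem F nu = q by rewrite didemC didem_dsq.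
have [[x0 w0]|none] := pselect (exists x, q * x * Q != 0); last first.
  exists 0; split=> // x; exists 0; rewrite scale0r; apply/eqP/negPn/negP => ne.
  by apply: none; exists x.
set w := q * x0 * Q in w0.
have eq x : q * x * didem F nu = q * x by rewrite -mulrA didemC mulrA qe.
have we : w * didem F nu = w by rewrite /w -(mulrA q) eq.
exists w; split=> [x|lanu]; last first.
  have QE : Q = Q * emb (didem F la) by rewrite -rmorphM didemC didem_dsq.
  by rewrite -we /w {1}QE -!mulrA emb_didem_orth // !mulr0.
have [_ /(_ (gstar x0 * q * q * x0) nu)[c cE]] := br la.
(* This product lies in the corner of [Q], so the multiplicity clause for [la] makes its component
   [nu] a scalar multiple; the scalar is nonzero because [w] is. *)
have ww : gstar w * w = c *: (Q * didem F nu).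
  by rewrite -{2}we -cE /w !gstarM Qs qs !mulrA.
have c0 : c != 0.
  have gw : gstar w != 0 by apply: contra_neq w0 => E; rewrite -[LHS]gstarK E raddf0.
  by have := mulstar_neq0 gw; rewrite gstarK ww; apply: contraNneq => ->; rewrite scale0r.
pose v := q * x * Q; have ve : v * didem F nu = v by rewrite /v -(mulrA q) eq.
have [c1 c1E] := dsq_corner nu (x * Q * Q * gstar x0).
(* This triple product is evaluated in two ways: [v * gstar w] lies in the corner of [q] and is a
   multiple of [q], while [gstar w * w] acts on [v] as a scalar. Hence [v] is a multiple of [w]. *)
have vww : v * gstar w * w = (c1 * kappa (young F (std nu))) *: w.
  have -> : v * gstar w = c1 *: q.
    by rewrite -c1E /v /w !gstarM Qs qs !mulrA.
  by rewrite -scalerAl /w !mulrA -/q dsq_idem -!scalerAl scalerA.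
exists ((c * kappa (young F (std la)))^-1 * (c1 * kappa (young F (std nu)))).
have vQ : v * Q = kappa (young F (std la)) *: v by rewrite /v -mulrA QK -scalerAr.
rewrite -/v -scalerA -vww -(mulrA v) ww -scalerAr mulrA vQ -scalerAl ve !scalerA.
by rewrite -mulrA mulVf ?scale1r // mulf_neq0 ?kappa_std_neq0.
Qed.

Definition last_transposition n : 'S_n.+2 := tperm (lift ord_max ord_max) ord_max.

(** By [projection_split], [x] is its projection times a transposition of the last point with some
    [a]; an element of S(n+1) moving [a] to its own last point conjugates that transposition to
    [last_transposition n]. *)
Lemma double_coset n (x : 'S_n.+2) : (exists g, x = sincl g) \/
  exists g h, x = (sincl g * last_transposition n * sincl h)%g.
Proof.
have := projection_split x; case: (unliftP ord_max (x ord_max)) => [a ->|->] E.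
  right; exists (canonical_projection x * tperm a ord_max)%g, (tperm a ord_max).
  rewrite [LHS]E sinclM -!mulgA; congr (_ * _)%g.
  have tV : sincl (tperm a ord_max) = (sincl (tperm a ord_max))^-1%g.
    by rewrite -sinclV tpermV.
  rewrite {1}tV /last_transposition -conjgE tpermJ /sincl lift_perm_id lift_perm_lift.
  by rewrite tpermR.
by left; exists (canonical_projection x); rewrite [LHS]E tperm1 mulg1.
Qed.

Lemma last_transpositionC n (u : A n) :
  gdelta F (last_transposition n) * emb (emb u) =
  emb (emb u) * gdelta F (last_transposition n).
Proof.
rewrite [u]galg_expand !linear_sum mulr_sumr mulr_suml; apply: eq_bigr => g _ /=.
rewrite !linearZ /= -scalerAr -scalerAl !emb_delta -!gdeltaM; congr (_ *: gdelta F _).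
apply: (mulgI (sincl (sincl g))^-1%g); rewrite mulKg -conjgE.
by rewrite tpermJ /sincl !lift_perm_id lift_perm_lift lift_perm_id.
Qed.

(** [Q] accounts for S(n+1), and [W la] for the part of the other double coset that passes through
    [la]. In Q g s h Q, insert a^-1 q q a with q = [dsq la] before s and move q a across s: the left
    half becomes a multiple of [w la], the right half one of its adjoint. As [w la] = 0 unless [la]
    is obtained by removing a box, the list has the right size. *)
Lemma corner_span n (nu : diagram n.+1) : complete n -> branches n ->
  exists2 X : seq (A n.+2), (size X <= #|[pred mu | adds_box nu mu]|)%N &
  forall x, emb (dsq nu) * x * emb (dsq nu) \in <<X>>%VS.
Proof.
move=> cn br; have /choice[w wP] la := corner_rank1 la nu br.
set Q := emb (dsq nu); set s := gdelta F (last_transposition n).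
pose W la := emb (w la) * s * emb (gstar (w la)).
exists (Q :: map W (enum [pred la | adds_box la nu])).
  by rewrite /= size_map -cardE card_addable.
move=> x; set U := <<_>>%VS.
have UQ : Q \in U by rewrite memv_span // mem_head.
have UW la : W la \in U.
  have [lanu|/(proj2 (wP la)) w0] := boolP (adds_box la nu); last first.
    by rewrite /W w0 linear0 !mul0r mem0v.
  by rewrite memv_span // inE map_f ?orbT // mem_enum.
rewrite [x]galg_expand mulr_sumr mulr_suml memv_suml // => y _.
rewrite -scalerAr -scalerAl memvZ //.
have [[g ->]|[g [h ->]]] := double_coset y.
  rewrite -emb_delta -!rmorphM /=; have [c ->] := dsq_corner nu (gdelta F g).
  by rewrite linearZ memvZ.
rewrite !gdeltaM -!emb_delta -/s.
have one : \sum_(la : diagram n) emb (emb (didem F la)) = 1.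
  by rewrite -(rmorph1 (@emb F n.+1)) -(rmorph1 (@emb F n)) -cn !rmorph_sum.
have -> : s = \sum_(la : diagram n) emb (emb (didem F la)) * s.
  by rewrite -mulr_suml one mul1r.
rewrite mulr_sumr mulr_suml mulr_sumr mulr_suml memv_suml // => la _.
have [k kE] := didem_sq_expand la.
rewrite kE !linear_sum !(mulr_sumr, mulr_suml) memv_suml // => a _.
rewrite /= !linearZ /= !(=^~ scalerAl, =^~ scalerAr) memvZ //.
have [c1 c1E] := (wP la).1 (gdelta F g * emb (gdelta F a^-1%g)).
have [c2 c2E] := (wP la).1 (gstar (emb (gdelta F a) * gdelta F h)).
have e1 : emb (dsq nu * (gdelta F g * emb (gdelta F a^-1%g)) * emb (dsq la)) =
    c1 *: emb (w la) by rewrite c1E linearZ.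
have e2 : emb (emb (dsq la) * (emb (gdelta F a) * gdelta F h) * dsq nu) =
    Num.conj c2 *: emb (gstar (w la)).
  rewrite -linearZ /= -gstarZ -c2E (gstarM (_ * _)) gstarM gstarK -emb_star !gstar_dsq.
  by rewrite !mulrA.
have comm := last_transpositionC (dsq la * gdelta F a).
suff -> : Q * (emb (gdelta F g) * (emb (emb (gdelta F a^-1 * (dsq la * dsq la) * gdelta F a)) * s) *
   emb (gdelta F h)) * Q = (c1 * Num.conj c2) *: W la by rewrite memvZ.
have -> : (c1 * Num.conj c2) *: W la =
    (c1 *: emb (w la)) * s * (Num.conj c2 *: emb (gstar (w la))).
  by rewrite -scalerAr -!scalerAl scalerA mulrC.
rewrite -e1 -e2; rewrite !rmorphM /= in comm *; rewrite -/s in comm.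
rewrite !mulrA -[in RHS](mulrA _ s) -[in RHS](mulrA _ (s * _)) -(mulrA s) comm.
by rewrite !mulrA.
Qed.

Lemma complete0 : complete 0.
Proof.
have didem1 (la : diagram 0) : didem F la = 1.
  have S0 (u : A 0) : u = u 1%g *: 1.
    rewrite [LHS]galg_expand (bigD1 1%g) //= big1 ?addr0 // => g /eqP[].
    by apply/permP => -[].
  have := didem_idem F la; rewrite [didem F la]S0; set c := didem F la 1%g => /eqP.
  rewrite -scalerAl mul1r scalerA -subr_eq0 -scalerBl scaler_eq0 oner_eq0 orbF subr_eq0.
  move/eqP=> cc; have c0 : c != 0.
    apply: contra_neq (cidem_neq0 (prim_std F la)) => c0.
    by rewrite -/(didem F la) [didem F la]S0 -/c c0 scale0r.
  by rewrite (mulfI c0 (etrans cc (esym (mulr1 c)))) scale1r.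
have [|||la _] := @diagram_exists 0 (fun=> 0%N) => //; first by rewrite big_ord0.
rewrite /complete (bigD1 la) //= didem1 big1 ?addr0 // => mu /eqP[].
by apply: diagram_ext => r; rewrite !row_length_big.
Qed.

Theorem complete_branches n : complete n /\ branches n.
Proof.
elim: n => [|n [cn br]].
  split; first exact: complete0.
  move=> la; apply: (@branches_of_span _ la [:: emb (dsq la)]) => [|x].
    have [//|nu nuE] := @addable_exists _ la 0 _ (or_introl erefl).
    by apply/card_gt0P; exists nu; rewrite inE; apply/adds_boxP; exists 0%N.
  rewrite span_seq1.
  (* S(1) is trivial, so [emb] from S(0) is onto and the corner is the line of [emb (dsq la)]. *)
  pose u : A 0 := [ffun g => x (sincl g)].
  have -> : x = emb u.
    apply/ffunP=> y; rewrite (projection_split y) [y _]ord1 [ord_max]ord1 tperm1 mulg1.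
    by rewrite emb_sincl ffunE.
  have [c E] := dsq_corner la u.
  by rewrite -!rmorphM /= E linearZ; apply/vlineP; exists c.
split; first exact: complete_step.
by move=> nu; have [X szX spX] := corner_span nu cn br; apply: branches_of_span szX spX.
Qed.
End Branching.

(** * The embedding L and contents *)

Section AddBoxComponent.
Variables (F : numClosedFieldType) (n : nat).
Local Notation A := (galg F 'S_n).
Local Notation B := (galg F 'S_n.+1).
Implicit Types (la : diagram n) (nu : diagram n.+1) (u : A).

Lemma sum_didem : \sum_(la : diagram n) didem F la = 1.
Proof. by have [] := complete_branches F n. Qed.

Lemma emb_component_out la nu u : u * didem F la = u -> ~~ adds_box la nu ->
  emb u * didem F nu = 0.
Proof.
move=> <- lanu; rewrite rmorphM -mulrA /= emb_didem_orth ?mulr0 //.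
by have [] := complete_branches F n.
Qed.

Lemma jucys_murphy_component la nu r u : u * didem F la = u ->
  (forall j, row_length nu j = (row_length la j + (j == r))%N) ->
  emb u * jucys_murphy F n * didem F nu =
    ((row_length la r)%:R - r%:R) *: (emb u * didem F nu).
Proof.
move=> ue nuE; have tt := std_tableau la; have tt' := ext_tableau tt nuE.
apply: (scalerI (a := 2%:R)); first by rewrite pnatr_eq0.
have jmE : 2%:R *: jucys_murphy F n = tsum F n.+1 - emb (tsum F n) - 1.
  by rewrite tsum_rec addrAC addrK addrAC subrr add0r.
rewrite scalerAl scalerAr jmE !mulrBr !mulrBl mulr1 -rmorphM /=.
rewrite (tsumC u) (tsum_didem tt ue) linearZ /= -scalerAl -mulrA.
rewrite (tsum_didem tt' (didem_idem F nu)) -scalerAr (theta_ext F tt nuE).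
by rewrite -[X in _ - _ - X = _]scale1r -!scalerBl scalerA; congr (_ *: _); ring.
Qed.
(** Up to cyclic order the left side is the trace v |-> tr([emb v] e_nu) at u u*, and
    [tracial_proportional] compares it with [gtr] on the block of [la]. This is why a transition
    ratio independent of the vector exists. *)
Lemma component_norm la nu : exists2 rho : F, 0 <= rho &
  forall u, u * didem F la = u ->
    gtr (emb u * didem F nu * gstar (emb u * didem F nu)) = rho * gtr (u * gstar u).
Proof.
pose f (v : A) : F := gtr (emb v * didem F nu).
have fC v w : f (v * w) = f (w * v).
  by rewrite /f !rmorphM /= -mulrA gtrC -!mulrA didemC.
have f_lin : scalar f.
  by move=> c v w; rewrite /f linearP /= mulrDl -scalerAl linearP.
have p := prim_std F la; set q := gsq (young F (std la)).
have key u : u * didem F la = u ->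
    gtr (emb u * didem F nu * gstar (emb u * didem F nu)) = f q / gtr q * gtr (u * gstar u).
  move=> ue; have q0 : gtr q != 0 by rewrite gt_eqF ?gtr_sq_gt0.
  apply: (mulIf q0); rewrite mulrAC divfK // [RHS]mulrC (gtrC u).
  rewrite -(tracial_proportional p fC f_lin); last by rewrite -mulrA ue.
  congr (_ * _); rewrite /f gstarM gstar_didem mulrA.
  rewrite -(mulrA _ (didem F nu) (didem F nu)) didem_idem.
  by rewrite gtrC mulrA -emb_star rmorphM.
exists (f q / gtr q) => //.
have qe : q * didem F la = q by rewrite didemC cidem_sq.
have := key q qe; set a := gtr _ => E; have : 0 <= a by apply: gtr_norm_ge0.
by rewrite E pmulr_lge0 // gtr_norm_gt0 ?gsq_neq0.
Qed.
End AddBoxComponent.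

Section LEmbedding.
Variables (R : realType) (n : nat) (z : R[i]).
Local Notation C := R[i].

Definition L_scale : C := sqrtC (n.+1%:R / (`|z| ^+ 2 + n%:R)).

Lemma Lembed_galg (f : galg C 'S_n) :
  Lembed z f = L_scale *: (emb f * (z%:A + jucys_murphy C n)) :> galg C 'S_n.+1.
Proof.
apply/ffunP=> x; rewrite ffunE [RHS]gscaleE [X in X * _ = _]mulrC -mulrA.
congr (_ * _); rewrite mulrDr gaddE -scalerAr mulr1 gscaleE /jucys_murphy mulr_sumr gsumE.
under [X in _ = _ + X]eq_bigr do rewrite gmul_delta tpermV.
have split := projection_split x.
(* If [x] moves the last point to [a], only the summand [a] of [jucys_murphy] survives; if [x] fixes
   it, only the term with [z] does. *)
case: (unliftP ord_max (x ord_max)) split => [a Ea|Ea] split; rewrite Ea.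
  rewrite eq_sym (negPf (neq_lift _ _)) mul1r emb_out ?mulr0 ?add0r; last first.
    by rewrite Ea eq_sym neq_lift.
  rewrite (bigD1 a) //= big1 ?addr0 => [|b ba].
    by rewrite [in RHS]split Ea -mulgA tperm2 mulg1 emb_sincl.
  apply: emb_out; rewrite permM Ea tpermD ?neq_lift //; first by rewrite eq_sym neq_lift.
  by rewrite (inj_eq (@lift_inj _ _)).
rewrite eqxx big1 ?addr0 => [|b _]; last first.
  by apply: emb_out; rewrite permM Ea tpermR eq_sym neq_lift.
by rewrite [in RHS]split Ea tperm1 mulg1 emb_sincl.
Qed.
End LEmbedding.

(** * The subspaces H(la) *)

Section SpechtModule.
Variables (R : realType) (n : nat) (la : diagram n).
Local Notation C := R[i].
Local Notation A := (galg C 'S_n).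
Local Notation N := (gcard [set: 'S_n]%G).
Local Notation U := (specht_mx R la).
Local Notation d := (\rank (specht_mx R la)).
Local Notation y := (young C (std la)).
Local Notation e := (didem C la).

Definition galg_of_row (v : 'rV[C]_N) : A :=
  [ffun g => v 0 (gring_index [set: 'S_n]%G g)].
Local Notation phi := galg_of_row.

Fact phi_linear : linear phi.
Proof. by move=> c u v; apply/ffunP=> g; rewrite gaddE gscaleE !ffunE !mxE. Qed.
HB.instance Definition _ := GRing.isLinear.Build C 'rV[C]_N A *:%R phi phi_linear.

Lemma gring_index_inj : injective (gring_index [set: 'S_n]%G).
Proof. by apply: (can_inj (g := enum_val)) => g; apply: gring_indexK; rewrite inE. Qed.

Lemma phi_inj : injective phi.
Proof.
move=> u v /ffunP E; apply/rowP => i.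
by have := E (enum_val i); rewrite !ffunE gring_valK.
Qed.

Lemma phi_delta g : phi (delta_mx 0 (gring_index _ g)) = gdelta C g.
Proof. by apply/ffunP=> h; rewrite !ffunE mxE eqxx (inj_eq gring_index_inj). Qed.

Lemma phi_regular v x : phi (v *m regular_repr C [set: 'S_n]%G x) = phi v * gdelta C x.
Proof.
apply/ffunP=> g; rewrite gmul_delta !ffunE mxE.
rewrite (bigD1 (gring_index _ (g * x^-1)%g)) //= big1 => [|i ne].
  by rewrite !mxE gring_indexK ?inE // mulgKV !eqxx mulr1 addr0.
rewrite !mxE eqxx /= (inj_eq gring_index_inj); case: eqP => [E|]; last by rewrite mulr0.
by rewrite E mulgK gring_valK eqxx in ne.
Qed.

Lemma phi_young : phi (young_symmetrizer R la) = y.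
Proof.
rewrite youngE row_sumE col_sumE /young_symmetrizer linear_sum mulr_suml.
apply: eq_bigr => h _; rewrite linear_sum mulr_sumr; apply: eq_bigr => v _.
by rewrite /= linearZ /= phi_delta gdeltaM scalerAr.
Qed.

(** A basis, inside the group algebra, of the right ideal of [y], to which [phi] carries the Specht
    module. *)
Definition specht_basis (i : 'I_d) : A := phi (row i (val_submod (U := U) 1%:M)).
Local Notation vb := specht_basis.

Lemma specht_basis_comb (w : 'rV[C]_d) :
  \sum_j w 0 j *: vb j = phi (val_submod (U := U) w).
Proof.
rewrite val_submodE mulmx_sum_row linear_sum; apply: eq_bigr => j _.
by rewrite linearZ.
Qed.

Lemma specht_basis_free (w : 'rV[C]_d) : \sum_j w 0 j *: vb j = 0 -> w = 0.
Proof.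
rewrite specht_basis_comb => E; apply/eqP; rewrite -(val_submod_eq0 (U := U)).
by apply/eqP/phi_inj; rewrite E linear0.
Qed.

Lemma specht_basis_repr i x : \sum_j irr R la x i j *: vb j = vb i * gdelta C x.
Proof.
have -> : \sum_j irr R la x i j *: vb j = \sum_j (row i (irr R la x)) 0 j *: vb j.
  by apply: eq_bigr => j _; rewrite [row _ _ _ _]mxE.
rewrite specht_basis_comb -phi_regular; congr phi.
have xG : x \in [set: 'S_n]%G by rewrite inE.
have := val_submodJ (cyclic_mx_module (regular_repr C [set: 'S_n]%G)
  (young_symmetrizer R la)) 1%:M xG.
by rewrite mul1mx [LHS]val_submodE => E; rewrite val_submodE -!row_mul -E.
Qed.

Lemma specht_basis_ideal i : exists u, vb i = y * u.
Proof.
have : (row i (val_submod (U := U) 1%:M) <= U)%MS.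
  by rewrite (submx_trans (row_sub _ _)) // val_submodP.
case/cyclic_mxP => M /envelop_mxP[a ->] E; exists (\sum_x a x *: gdelta C x).
rewrite /vb E mulmx_sumr linear_sum mulr_sumr.
apply: eq_big => [x|x _]; first by rewrite inE.
by rewrite -scalemxAr linearZ /= phi_regular phi_young scalerAr.
Qed.

Lemma specht_basis_span u : exists w : 'rV[C]_d, y * u = \sum_j w 0 j *: vb j.
Proof.
pose M := \sum_(x in [set: 'S_n]%G) u x *: regular_repr C [set: 'S_n]%G x.
have MU : (young_symmetrizer R la *m M <= U)%MS.
  by apply/cyclic_mxP; exists M => //; apply/envelop_mxP; exists u.
exists (in_submod U (young_symmetrizer R la *m M)).
rewrite specht_basis_comb in_submodK // /M mulmx_sumr linear_sum [in LHS](galg_expand u) mulr_sumr.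
apply: eq_big => [x|x _]; first by rewrite inE.
by rewrite -scalemxAr linearZ /= phi_regular phi_young scalerAr.
Qed.

(** Right multiplication by [e] fixes the right ideal of [y], hence every basis vector. *)
Lemma irr_didem : \sum_s e s *: irr R la s = 1%:M.
Proof.
apply/row_matrixP => i; apply/eqP; rewrite -subr_eq0; apply/eqP.
apply: specht_basis_free; set w := _ - _.
have wE j : w 0 j = (\sum_s e s * irr R la s i j) - (i == j)%:R.
  by rewrite /w !mxE summxE; congr (_ - _); apply: eq_bigr => s _; rewrite mxE.
under eq_bigr do rewrite wE scalerBl scaler_suml.
rewrite sumrB exchange_big /=; apply/eqP; rewrite subr_eq0; apply/eqP.
have -> : \sum_j (i == j)%:R *: vb j = vb i.
  rewrite (bigD1 i) //= eqxx scale1r big1 ?addr0 // => j ne.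
  by rewrite eq_sym (negPf ne) scale0r.
have [u uE] := specht_basis_ideal i.
have -> : vb i = vb i * e.
  by rewrite uE -mulrA didemC mulrA (mul_didem_tableau _ (std_tableau la)).
rewrite [X in _ * X]galg_expand mulr_sumr; apply: eq_bigr => s _.
rewrite -scalerAr -specht_basis_repr scaler_sumr; apply: eq_bigr => j _.
by rewrite scalerA.
Qed.

Lemma Reg_galg (s : 'S_n * 'S_n) (f : A) :
  Reg s f = gdelta C s.1^-1%g * f * gdelta C s.2 :> A.
Proof.
by apply/ffunP=> x; rewrite ffunE gmul_delta delta_gmul invgK mulgA.
Qed.

(** The intertwiner sending v (x) w to [gflip v * w]: the flip turns the right action on the first
    factor into left multiplication by the inverse, as in [Reg_galg]. *)
Definition specht_coef (M : 'M[C]_d) : L2 R n :=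
  \sum_i \sum_j M i j *: (gflip (vb i) * vb j) : A.

Fact specht_coef_linear : linear specht_coef.
Proof.
move=> c M M'; rewrite /specht_coef.
transitivity (c *: (\sum_i \sum_j M i j *: (gflip (vb i) * vb j))
  + (\sum_i \sum_j M' i j *: (gflip (vb i) * vb j)) : A) => //.
rewrite scaler_sumr -big_split; apply: eq_bigr => i _ /=.
rewrite scaler_sumr -big_split; apply: eq_bigr => j _ /=.
by rewrite !mxE scalerDl scalerA.
Qed.
HB.instance Definition _ :=
  GRing.isLinear.Build C 'M[C]_d (L2 R n) *:%R specht_coef specht_coef_linear.

Lemma specht_coef_equivariant s M : specht_coef (irr2 s M) = Reg s (specht_coef M).
Proof.
rewrite Reg_galg.
pose X := irr R la s.1; pose Y := irr R la s.2.
have -> : gdelta C s.1^-1%g * specht_coef M * gdelta C s.2 =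
    \sum_i \sum_j \sum_k \sum_l (X i k * M i j * Y j l) *: (gflip (vb k) * vb l) :> A.
  rewrite /specht_coef mulr_sumr mulr_suml; apply: eq_bigr => i _.
  rewrite mulr_sumr mulr_suml; apply: eq_bigr => j _.
  have -> : gdelta C s.1^-1%g * (M i j *: (gflip (vb i) * vb j)) * gdelta C s.2 =
      M i j *: (gflip (vb i * gdelta C s.1) * (vb j * gdelta C s.2)).
    by rewrite gflipM gflip_delta -scalerAr -scalerAl !mulrA.
  rewrite -!specht_basis_repr linear_sum mulr_suml scaler_sumr; apply: eq_bigr => k _.
  rewrite mulr_sumr scaler_sumr; apply: eq_bigr => l _.
  by rewrite /= linearZ /= -scalerAl -scalerAr !scalerA -mulrA mulrCA mulrA.
have -> : specht_coef (irr2 s M) =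
    \sum_k \sum_l \sum_j \sum_i (X i k * M i j * Y j l) *: (gflip (vb k) * vb l) :> A.
  apply: eq_bigr => k _; apply: eq_bigr => l _; rewrite /irr2 [X in X *: _]mxE scaler_suml.
  apply: eq_bigr => j _; rewrite [X in X * _]mxE mulr_suml scaler_suml.
  by apply: eq_bigr => i _; rewrite [X in X * _ * _]mxE.
rewrite [LHS]pair_bigA [RHS]pair_bigA.
under [RHS]eq_bigr do rewrite pair_bigA.
rewrite [RHS]exchange_big /=; apply: eq_bigr => kl _.
by rewrite exchange_big pair_bigA.
Qed.

Lemma specht_coef_rank1 u v : exists M, gflip (y * u) * (y * v) = specht_coef M :> A.
Proof.
have [a ->] := specht_basis_span u; have [b ->] := specht_basis_span v.
exists (\matrix_(i, j) (a 0 i * b 0 j)).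
rewrite linear_sum mulr_suml; apply: eq_bigr => i _.
rewrite mulr_sumr; apply: eq_bigr => j _.
by rewrite /= linearZ /= -scalerAl -scalerAr scalerA mxE.
Qed.

(** Since [e] acts as the identity on the second tensor factor, any intertwiner carries this to
    right multiplication by [e]. Conversely, each term of f e, with [e] expanded over the conjugates
    of [gsq y], is a value of [specht_coef]. *)
Lemma Hla_galg (f : A) : Hla la f <-> f * e = f.
Proof.
split=> [[Phi PhiE [M ->]]|fe].
  have {2}-> : M = \sum_s e s *: irr2 (1%g, s) M.
    rewrite /irr2 /= repr_mx1 trmx1 mul1mx -[LHS]mulmx1 -irr_didem mulmx_sumr.
    by apply: eq_bigr => s _; rewrite -scalemxAr.
  rewrite [in LHS](galg_expand e) mulr_sumr linear_sum; apply: eq_bigr => s _.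
  by rewrite linearZ /= PhiE Reg_galg /= invg1 gdelta1 mul1r -scalerAr.
exists specht_coef; first exact: specht_coef_equivariant.
have p := prim_std C la.
have /choice[g gP] : forall s : 'S_n, exists M,
    f * (gdelta C s^-1%g * gsq y * gdelta C s) = specht_coef M :> A.
  move=> s; set x := f * gdelta C s^-1%g.
  have [M ME] := specht_coef_rank1 (gflip (x * y)) (gstar y * gdelta C s).
  exists ((kappa y)^-1 *: M); rewrite linearZ /= -ME gflipM gflipK.
  have -> : gflip y = gstar y by rewrite /gstar gconj_young.
  have -> : gsq y = (kappa y)^-1 *: (gsq y * gsq y).
    by rewrite gsq_idem // scalerA mulVf ?scale1r ?kappa_neq0.
  by rewrite -!(scalerAr, scalerAl) gsqE /x !mulrA.
exists (\sum_s (central_scale y)^-1 *: g s); rewrite linear_sum -[LHS]fe /didem cidem_expand.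
rewrite mulr_sumr; apply: eq_bigr => s _.
by rewrite linearZ /= -gP -scalerAr.
Qed.
End SpechtModule.

(** * The sets Y(p,q) *)

Section HookStrips.
Variable n : nat.
Implicit Types (la : diagram n).

Lemma num_rows_le la p : (num_rows la <= p)%N = (row_length la p <= 0)%N.
Proof.
have [m mP] := col_length_exists la.
suff -> : num_rows la = m 0%N by rewrite leqNgt -mP -leqNgt.
have mn : (m 0 <= n)%N by rewrite leqNgt -mP row_length_big.
rewrite /num_rows -sum1_count (big_nth 0%N) size_row_lengths.
rewrite -[RHS]muln1 -[X in (X * _)%N]subn0 -sum_nat_const_nat.
by rewrite [RHS](big_nat_widen _ _ n) //; apply: eq_bigl => i; rewrite -mP.
Qed.

(** The three cases of [in_Ypq] become a lower bound on row p-1 and an upper bound on row p, rows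
    being numbered from 0. *)
Lemma in_YpqE p q la : (p, q) != (0%N, 0%N) ->
  in_Ypq p q la = [|| q == 0, p == 0 | q <= row_length la p.-1]%N && (row_length la p <= q)%N.
Proof.
rewrite /in_Ypq /has_box; case: q => [|q] /=; first by rewrite num_rows_le.
by case: p => [|p] //= _; rewrite -leqNgt.
Qed.

End HookStrips.

(** Only two boxes can matter: one that makes row p exceed q, and one that makes row p-1 reach q.
    Both have content q-p. *)
Lemma in_Ypq_change n p q (la : diagram n) (nu : diagram n.+1) r : (p, q) != (0%N, 0%N) ->
  (forall j, row_length nu j = (row_length la j + (j == r))%N) ->
  in_Ypq p q la != in_Ypq p q nu -> (row_length la r + p = q + r)%N.
Proof.
move=> pq nuE; rewrite !in_YpqE // !nuE.
have [->|] := eqVneq p r; have [<-|] := eqVneq p.-1 r; lia.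
Qed.

(** If q < q' then also p < p', since p-q is fixed, and monotonicity of the rows would give q' <=
    q. *)
Lemma in_Ypq_uniq n k p q p' q' (la : diagram n) : admissible k (p, q) -> admissible k (p', q') ->
  in_Ypq p q la -> in_Ypq p' q' la -> (p, q) = (p', q').
Proof.
wlog lt : p q p' q' / (q < q')%N => [W|] a a' Y Y'.
  have [lt|lt|E] := ltngtP q q'; first by apply: (W p q p' q').
    by apply/esym; apply: (W p' q' p q).
  move: a a'; rewrite /admissible /= E => /andP[_ /eqP <-] /andP[_ /eqP kE].
  by have -> : p = p' by lia.
move: a a' Y Y'; rewrite /admissible /= => /andP[pq /eqP kE] /andP[pq' /eqP kE'].
rewrite !in_YpqE // => /andP[_ le] /andP[].
have p'p : (p <= p'.-1)%N by lia.
have := row_length_noninc la p'p; lia.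
Qed.

Lemma in_Ypq_exists n k (la : diagram n) : (0 < n)%N ->
  exists pq, admissible k pq /\ in_Ypq pq.1 pq.2 la.
Proof.
(* [P q] says that the box (q+k+1, q+1), numbered from 1, is outside [la]. The least such q leaves
   the preceding box of the diagonal, if any, inside [la]. *)
move=> n0; pose P q := (0 <= q%:Z + k) && (row_length la (absz (q%:Z + k)%R) <= q)%N.
have ex : exists q, P q.
  exists (n + absz k)%N; rewrite /P; apply/andP; split; first lia.
  by rewrite (leq_trans (row_length_le _ _)) // leq_addr.
have := ex_minnP ex; case=> q /andP[qk le] min.
set p := (absz (q%:Z + k)%R) in le.
have pq : (p, q) != (0%N, 0%N).
  apply/eqP=> -[p0 q0]; move: le; rewrite p0 q0 leqn0 => /eqP r0.
  have := sum_row_length la; rewrite big1 => [E|i _]; first by rewrite -E in n0.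
  by apply/eqP; rewrite -leqn0 -[leqRHS]r0 row_length_noninc.
exists (p, q); split; first by rewrite /admissible pq /=; lia.
have pk : p%:Z = q%:Z + k by rewrite /p; lia.
clearbody p; rewrite /= in_YpqE // le andbT.
case: q min pq le qk pk => [//|q] min pq le qk pk.
rewrite /=; case: (eqVneq p 0%N) => //= p0; rewrite leqNgt; apply/negP => lt.
have : P q by apply/andP; split; [lia|]; rewrite (_ : (absz (q%:Z + k)%R) = p.-1); lia.
by move/min; rewrite ltnn.
Qed.

(** * The projections onto the spaces H^n_pq and the embedding L *)

Section HookIdempotent.
Variables (F : numClosedFieldType) (p q : nat).
Local Notation A n := (galg F 'S_n).

Definition hook_idem n : A n := \sum_(la | in_Ypq p q la) didem F la.
Local Notation E := hook_idem.

Lemma hook_idemC n u : u * E n = E n * u.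
Proof. by rewrite /E mulr_sumr mulr_suml; apply: eq_bigr => la _; rewrite didemC. Qed.

Lemma didem_hook n (la : diagram n) :
  didem F la * E n = if in_Ypq p q la then didem F la else 0.
Proof.
rewrite /E mulr_sumr; have [Y|Y] := boolP (in_Ypq p q la).
  rewrite (bigD1 la) //= didem_idem big1 ?addr0 // => mu /andP[_ ne].
  by rewrite didem_orth // eq_sym.
rewrite big1 // => mu Ymu; rewrite didem_orth //.
by apply: contraNneq Y => ->.
Qed.

Lemma hook_idem_idem n : E n * E n = E n.
Proof.
rewrite {1}/E mulr_suml [RHS]/E; apply: eq_bigr => la Y.
by rewrite didem_hook Y.
Qed.

Lemma gstar_hook_idem n : gstar (E n) = E n.
Proof. by rewrite /E raddf_sum; apply: eq_bigr => la _; exact: gstar_didem. Qed.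

Lemma hook_idem_translate n (f a b : A n) :
  f * E n = f -> a * f * b * E n = a * f * b.
Proof. by move=> fE; rewrite -mulrA hook_idemC mulrA -(mulrA a) fE. Qed.

Lemma hook_idemP n (f : A n) : f * E n = f <->
  exists2 h : diagram n -> A n, (forall la, h la * didem F la = h la)
    & f = \sum_(la | in_Ypq p q la) h la.
Proof.
split=> [fE|[h hP ->]].
  exists (fun la => f * didem F la) => [la|]; first by rewrite -mulrA didem_idem.
  by rewrite -[LHS]fE /E mulr_sumr.
rewrite mulr_suml; apply: eq_bigr => la Y.
by rewrite -hP -mulrA didem_hook Y.
Qed.

Variables (k : int) (n : nat) (c : F).
Hypothesis adm : admissible k (p, q).
Local Notation L u := (c *: (emb u * (k%:~R%:A + jucys_murphy F n))).

Lemma L_component_content (la : diagram n) (nu : diagram n.+1) r (u : A n) :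
  u * didem F la = u ->
  (forall j, row_length nu j = (row_length la j + (j == r))%N) ->
  L u * didem F nu =
    (c * (k%:~R + ((row_length la r)%:R - r%:R))) *: (emb u * didem F nu).
Proof.
move=> ue nuE; rewrite -scalerAl mulrDr mulrDl -scalerA; congr (_ *: _).
rewrite (jucys_murphy_component ue nuE) [RHS]scalerDl; congr (_ + _).
by rewrite mulr_algr -scalerAl.
Qed.

Lemma L_component_out (la : diagram n) (nu : diagram n.+1) (u : A n) :
  u * didem F la = u -> ~~ adds_box la nu -> L u * didem F nu = 0.
Proof.
move=> ue lanu; rewrite -scalerAl -mulrA didemC mulrA.
by rewrite (emb_component_out ue lanu) mul0r scaler0.
Qed.

Lemma L_component_change (la : diagram n) (nu : diagram n.+1) (u : A n) :
  u * didem F la = u -> in_Ypq p q la != in_Ypq p q nu -> L u * didem F nu = 0.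
Proof.
move=> ue; case/andP: adm => /= pq /eqP kE Y.
have [/adds_boxP[r _ nuE]|] := boolP (adds_box la nu); last exact: L_component_out ue.
rewrite (L_component_content ue nuE).
have /(congr1 (fun m : nat => m%:R : F)) := in_Ypq_change pq nuE Y; rewrite !natrD => E'.
rewrite (_ : _ + _ = 0) ?mulr0 ?scale0r //.
rewrite -kE rmorphB /= -!pmulrn.
apply/eqP; rewrite -(subrr (q%:R + r%:R : F)) -{1}E'; apply/eqP; ring.
Qed.

Lemma L_hook (u : A n) : L (u * E n) = L u * E n.+1.
Proof.
have Lsum I (s : seq I) (P : pred I) (f : I -> A n) :
    L (\sum_(i <- s | P i) f i) = \sum_(i <- s | P i) L (f i).
  by rewrite linear_sum mulr_suml scaler_sumr.
have LE la (v : A n) : v * didem F la = v ->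
    L v * E n.+1 = if in_Ypq p q la then L v else 0.
  move=> ve; have {2}-> : L v = \sum_nu L v * didem F nu.
    by rewrite -mulr_sumr sum_didem mulr1.
  rewrite [in LHS]/E mulr_sumr big_mkcond; case: ifP => Y.
    apply: eq_bigr => nu _; case: ifPn => // nY.
    by rewrite (L_component_change ve) // Y (negPf nY).
  by rewrite big1 // => nu _; case: ifP => // nY; rewrite (L_component_change ve) // Y nY.
have uE : u = \sum_la u * didem F la by rewrite -mulr_sumr sum_didem mulr1.
rewrite [in RHS]uE Lsum mulr_suml /E mulr_sumr Lsum big_mkcond; apply: eq_bigr => la _.
by rewrite (LE la) // -mulrA didem_idem.
Qed.
End HookIdempotent.

Lemma hook_idem_orth (F : numClosedFieldType) k p q p' q' n :
  admissible k (p, q) -> admissible k (p', q') -> (p, q) != (p', q') ->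
  hook_idem F p q n * hook_idem F p' q' n = 0.
Proof.
move=> a a' ne; rewrite [X in X * _]/hook_idem mulr_suml big1 // => la Y.
rewrite didem_hook; case: ifP => // Y'; case/eqP: ne.
exact: in_Ypq_uniq a a' Y Y'.
Qed.

(** * The inductive limit *)

Section DenseArguments.
Variables (R : realType) (H : completeNormedModType R[i]).
Local Notation C := R[i].
Variable dot : {dot H for Num.conj}.
Hypothesis norm_dot : forall x : H, `|x| ^+ 2 = dot x x.
Implicit Types x y : H.

Lemma dotC x y : dot x y = Num.conj (dot y x).
Proof. by rewrite hermC expr0 mul1r. Qed.

Lemma dot_self0 x : dot x x = 0 -> x = 0.
Proof. by rewrite -norm_dot => /eqP; rewrite sqrf_eq0 normr_eq0 => /eqP. Qed.

(** Cauchy-Schwarz, from Pythagoras for [x] split into its component along [y] and the remainder. *)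
Lemma dot_bound x y : `|dot x y| <= `|x| * `|y|.
Proof.
have [->|y0] := eqVneq y 0; first by rewrite linear0r !normr0 mulr0.
have yy : 0 < dot y y by rewrite -norm_dot exprn_gt0 ?normr_gt0.
rewrite -(ler_pXn2r (n := 2)) ?nnegrE ?mulr_ge0 // exprMn !norm_dot.
pose a := dot x y / dot y y; have ou : dot (x - a *: y) (a *: y) = 0.
  by rewrite linearZr_LR /= linearBl /= linearZl_LR /= divfK ?gt_eqF // subrr mulr0.
have E : dot x x = dot (x - a *: y) (x - a *: y) + `|a| ^+ 2 * dot y y.
  rewrite -dnormZ -hnormDd ?subrK //.
rewrite E mulrDl -mulrA -expr2 -exprMn -{2}(gtr0_norm yy) -normrM divfK ?gt_eqF //.
by rewrite lerDr mulr_ge0 // -norm_dot exprn_ge0.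
Qed.

Lemma closure_normP (S : set H) x :
  closure S x <-> forall e : C, 0 < e -> exists2 y, S y & `|x - y| < e.
Proof.
split=> [cl e e0|h B].
  have [y [Sy]] := cl (ball x e) (nbhsx_ballx x e e0).
  by rewrite -ball_normE => xy; exists y.
rewrite -nbhs_ballE => -[e /= e0 eB]; have [y Sy xy] := h e e0.
by exists y; split=> //; apply: eB; rewrite -ball_normE.
Qed.

Definition norm_dense (D : set H) := forall x (e : C), 0 < e ->
  exists2 y, D y & `|x - y| < e.

Lemma dense_vanish (W : normedZmodType C) (G : H -> W) (M : C) (D : set H) :
  norm_dense D -> 0 < M -> (forall x y, `|G x - G y| <= M * `|x - y|) ->
  (forall x, D x -> G x = 0) -> forall x, G x = 0.
Proof.
move=> Dd M0 GM G0 x; apply/eqP; rewrite -normr_le0 real_leNgt ?real0 ?normr_real //.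
apply/negP => Gx; have [y Dy] := Dd x (`|G x| / M) (divr_gt0 Gx M0).
rewrite ltr_pdivlMr // mulrC => /(le_lt_trans (GM x y)).
by rewrite (G0 _ Dy) subr0 ltxx.
Qed.

Lemma bounded_continuous (A : {linear H -> H}) (M : C) : 0 < M ->
  (forall x, `|A x| <= M * `|x|) -> continuous A.
Proof.
move=> M0 AM; apply/linear_bounded_continuous/bounded_funP => r.
by exists (M * r) => x xr; rewrite (le_trans (AM x)) // ler_pM2l.
Qed.

Lemma continuous_bounded (A : {linear H -> H}) : continuous A ->
  exists2 M : C, 0 < M & forall x, `|A x| <= M * `|x|.
Proof.
move=> /linear_bounded_continuous/linear_boundedP near_oo.
near (pinfty_nbhs C) => M; exists M; near: M; last exact: near_oo.
exact: nbhs_pinfty_gt.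
Unshelve. all: by end_near. Qed.

Lemma orth_projE (W : set H) x y : (forall a b, W a -> W b -> W (a - b)) ->
  W y -> (forall w, W w -> dot (x - y) w = 0) -> orth_proj dot W x = y.
Proof.
move=> WB Wy xy; apply: xget_unique => [//|y' [Wy' xy']].
apply/eqP; rewrite -subr_eq0; apply/eqP/dot_self0.
have E : y' - y = (x - y) - (x - y') by rewrite opprB [RHS]addrC addrA subrK.
have yy : W (y' - y) by apply: WB.
transitivity (dot (x - y) (y' - y) - dot (x - y') (y' - y)); first by rewrite -linearBl -E.
by rewrite xy // xy' // subrr.
Qed.
End DenseArguments.

Lemma Sinf_is_exists (g : Sinf) : exists N, forall n, (N <= n)%N ->
  exists s : 'S_n, Sinf_is g s.
Proof.
have [N gN] := Sinf_fin g; exists N => n Nn.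
have gI : injective g by apply: bij_inj (Sinf_bij g).
have lt (i : 'I_n) : (g i < n)%N.
  rewrite ltnNge; apply/negP => le; have := gN (g i) (leq_trans Nn le).
  by move/gI => E; move: le; rewrite E leqNgt ltn_ord.
have sI : injective (fun i : 'I_n => Ordinal (lt i)).
  by move=> i j [/gI/val_inj].
exists (perm sI); split=> [i|i ni]; first by rewrite permE.
by rewrite gN // (leq_trans Nn).
Qed.

Section InductiveLimit.
Variables (R : realType) (k : int) (H : completeNormedModType R[i]).
Local Notation C := R[i].
Variables (dot : {dot H for Num.conj}) (iota : forall n, {linear L2 R n -> H}).
Variable T : G -> {linear H -> H}.
Hypothesis norm_dot : forall x : H, `|x| ^+ 2 = dot x x.
Hypothesis T_k : is_T dot iota k%:~R T.
Local Notation A n := (galg C 'S_n).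

(** [iota n] with its source retyped, so that its linearity applies to expressions of the group
    algebra. *)
Definition giota n : A n -> H := iota n.
Fact giota_linear n : linear (@giota n).
Proof. exact: (linearP (iota n)). Qed.
HB.instance Definition _ n := GRing.isLinear.Build C (A n) H *:%R (@giota n) (@giota_linear n).

Definition lembed n : A n -> A n.+1 := @Lembed R k%:~R n.

Lemma giota_lembed n (f : A n) : (1 <= n)%N -> giota (lembed f) = giota f.
Proof. by move=> n1; exact: (il_compat T_k n1). Qed.

Lemma dot_giotaE n (f g : A n) : (1 <= n)%N ->
  dot (giota f) (giota g) = (n`!%:R)^-1 * gtr (f * gstar g).
Proof.
move=> n1; have := @il_isometry _ _ _ _ _ _ _ _ _ T_k n n1 f g Logic.I Logic.I.
by move=> /= ->; rewrite gtr_mulstar.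
Qed.

Lemma giota_lift m n (f : A m) : (1 <= m)%N -> (m <= n)%N ->
  exists f' : A n, giota f' = giota f.
Proof.
move=> m1 /subnK <-; elim: (n - m)%N => [|d [f' E]]; first by exists f.
by exists (lembed f'); rewrite giota_lembed // (leq_trans m1) // leq_addl.
Qed.

(** The lower bound [N] is there because a given element of G belongs to G(n) only for large n. *)
Definition levels (N : nat) : set H :=
  [set x | exists n (f : A n), [/\ (1 <= n)%N, (N <= n)%N & x = giota f]].

Lemma levels_dense N : norm_dense (levels N).
Proof.
move=> x e e0; have : [set: H] x by [].
rewrite (il_completion T_k) => /closure_normP/(_ e e0)[y [n /= n1 [f _ <-]] xy].
have [f' E] := giota_lift f n1 (leq_maxl n N).
exists (iota n f) => //; exists (maxn n N), f'; split=> //.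
  by rewrite (leq_trans n1) // leq_maxl.
exact: leq_maxr.
Qed.

(** The adjoint of [giota]; the factorial undoes the uniform probability measure, for which a delta
    function has squared norm 1/n!. *)
Definition coords n (x : H) : A n :=
  [ffun s => n`!%:R * dot x (giota (gdelta C s))].

Lemma fact_neq0 n : n`!%:R != 0 :> C.
Proof. by rewrite pnatr_eq0 -lt0n fact_gt0. Qed.

Lemma dot_giotar n x (f : A n) :
  dot x (giota f) = (n`!%:R)^-1 * gtr (coords n x * gstar f).
Proof.
rewrite gtr_mulstar [in LHS](galg_expand f) linear_sum linear_sumr mulr_sumr.
apply: eq_bigr => s _; rewrite /= linearZ /= linearZr_LR /= ffunE.
by rewrite -!mulrA mulKf ?fact_neq0 // mulrC.
Qed.

Lemma coords_giota n (f : A n) : (1 <= n)%N -> coords n (giota f) = f.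
Proof.
move=> n1; apply/ffunP=> s; rewrite ffunE dot_giotaE // mulVKf ?fact_neq0 //.
by rewrite gstar_delta /gtr gmul_delta invgK mul1g.
Qed.

Fact coords_linear n : linear (coords n).
Proof.
move=> c x y; apply/ffunP=> s; rewrite gaddE gscaleE !ffunE.
by rewrite linearDl linearZl_LR mulrDr mulrCA.
Qed.
HB.instance Definition _ n := GRing.isLinear.Build C H (A n) *:%R (coords n) (@coords_linear n).

Section Proj.
Variables (n : nat) (u : A n).
Hypotheses (n1 : (1 <= n)%N) (uu : u * u = u) (us : gstar u = u).

Definition proj (x : H) : H := giota (coords n x * u).

Lemma proj_orth x f : f * u = f -> dot (x - proj x) (giota f) = 0.
Proof.
move=> fu; have fs : u * gstar f = gstar f by rewrite -{2}fu gstarM us.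
by rewrite linearBl /= dot_giotaE // dot_giotar -mulrBr -(mulrA _ u) fs subrr mulr0.
Qed.

Lemma proj_norm x : `|proj x| <= `|x|.
Proof.
rewrite -(ler_pXn2r (n := 2)) ?nnegrE // !norm_dot.
have E : dot (x - proj x) (proj x) = 0 by apply: proj_orth; rewrite -mulrA uu.
rewrite -[X in _ <= dot X X](subrK (proj x)) hnormDd // lerDr.
exact: dnorm_ge0.
Qed.

Lemma orth_proj_giota (W : set H) x : W = [set giota f | f in [set f : A n | f * u = f]] ->
  orth_proj dot W x = proj x.
Proof.
move=> ->; apply: orth_projE => // [_ _ [f fu <-] [g gu <-]||_ [f fu <-]].
- by exists (f - g); rewrite ?linearB //= mulrBl fu gu.
- by exists (coords n x * u) => //=; rewrite -mulrA uu.
exact: proj_orth.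
Qed.
End Proj.

Lemma P_nE n x : (1 <= n)%N -> P_n dot iota n x = giota (coords n x).
Proof.
move=> n1; rewrite -[coords n x]mulr1; apply: orth_proj_giota => //.
- exact: mulr1.
- by rewrite -gdelta1 gstar_delta invg1.
by apply/seteqP; split=> y [f] /= fT <-; exists f => //=; rewrite mulr1.
Qed.

Lemma P_laE n (la : diagram n) x : (1 <= n)%N ->
  P_la dot iota la x = giota (coords n x * didem C la).
Proof.
move=> n1; apply: orth_proj_giota => //; rewrite ?didem_idem ?gstar_didem //.
by apply/seteqP; split=> y [f] /Hla_galg fu <-; exists f => //; apply/Hla_galg.
Qed.

Lemma T_giota n g s (f : A n) : (1 <= n)%N -> G_is g s ->
  T g (giota f) = giota (gdelta C s.1^-1%g * f * gdelta C s.2).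
Proof.
by move=> n1 gs; have := il_equivariant T_k n1 gs (f := f) Logic.I; rewrite Reg_galg.
Qed.

Lemma G_is_exists (g : G) : exists N, forall n, (N <= n)%N ->
  exists s : 'S_n * 'S_n, G_is g s.
Proof.
have [N1 h1] := Sinf_is_exists g.1; have [N2 h2] := Sinf_is_exists g.2.
exists (maxn N1 N2) => n; rewrite geq_max => /andP[/h1[s1 g1] /h2[s2 g2]].
by exists (s1, s2).
Qed.

Lemma T_norm g x : `|T g x| = `|x|.
Proof.
apply/eqP; rewrite -(eqrXn2 (n := 2)) // !norm_dot; apply/eqP.
by have [_ _ _ ->] := il_unitary T_k.
Qed.

(** * The limit operators A_pq *)

Section HookOperator.
Variables (p q : nat).
Hypothesis adm : admissible k (p, q).
Local Notation E := (hook_idem C p q).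

Lemma lembed_hook n (f : A n) : lembed (f * E n) = lembed f * E n.+1.
Proof. by rewrite /lembed !Lembed_galg; exact: (L_hook _ adm). Qed.

(** Climbing one level at a time, the idempotent commutes with [lembed]. So the projections are
    eventually constant on a dense set, and being contractions they converge everywhere. *)
Lemma proj_stable m n (f : A m) : (1 <= m)%N -> (m <= n)%N ->
  proj (E n) (giota f) = giota (f * E m).
Proof.
move=> m1 mn; rewrite -(subnK mn); move: (n - m)%N => d {mn}.
elim: d m f m1 => [|d IH] m f m1.
  by rewrite /proj coords_giota.
rewrite addSnnS -(giota_lembed f m1) IH // -lembed_hook.
by rewrite (giota_lembed (f * E m) m1).
Qed.

Lemma proj_cvg x : cvg (proj (E n.+1) x @[n --> \oo]).
Proof.
apply/cauchy_cvgP/cauchy_exP => e e0.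
have [y [m [f [m1 _ ->]]] xy] := levels_dense 1 x e0.
exists (giota (f * E m)); exists m => //= n /= mn.
rewrite -ball_normE /= -(@proj_stable m n.+1) ?leqW // -normrN opprB /proj.
rewrite -linearB -mulrBl -linearB /=.
by apply: le_lt_trans xy; apply: proj_norm; rewrite ?hook_idem_idem ?gstar_hook_idem.
Qed.

Lemma hook_operator_exists : exists B : {linear H -> H},
  (forall n (f : A n), (1 <= n)%N -> B (giota f) = giota (f * E n)) /\
  (forall x, `|B x| <= 2%:R * `|x|).
Proof.
pose B x := lim (proj (E n.+1) x @[n --> \oo]).
have Bcvg x : proj (E n.+1) x @[n --> \oo] --> B x by exact: (@proj_cvg x).
have Blin : linear B.
  move=> c x y; apply/cvg_lim => //.
  have -> : (fun n => proj (E n.+1) (c *: x + y)) =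
      (fun n => c *: proj (E n.+1) x + proj (E n.+1) y).
    by apply/funext => n; rewrite /proj linearP mulrDl -scalerAl linearP.
  by apply: cvgD (Bcvg y); apply: cvgZr (Bcvg x).
pose BL : {linear H -> H} := HB.pack B (GRing.isLinear.Build C H H *:%R B Blin).
exists BL; split=> [n f n1|x] /=.
  apply/cvg_lim => //; apply: cvg_near_cst; exists n => //= m /= nm.
  by apply: proj_stable; rewrite ?leqW.
have [->|x0] := eqVneq x 0.
  by rewrite -[B 0]/(BL 0) linear0 normr0 mulr0.
(* One term of the sequence within |x| of the limit, itself of norm at most |x|, already gives the
   constant 2. *)
have /cvgrPdist_le/(_ `|x|) := Bcvg x; rewrite normr_gt0 => /(_ x0)[N _ /(_ N (leqnn N))] /= le.
rewrite -[B x](subrK (proj (E N.+1) x)) (le_trans (ler_normD _ _)) // mulr_natl mulr2n.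
by rewrite lerD // proj_norm ?hook_idem_idem ?gstar_hook_idem.
Qed.
End HookOperator.

(** This reduces identities between bounded maps to the levels. Any [M] will do, so the constants 4
    and 6 in its uses are just sums and products of the bound 2. *)
Lemma levels_vanish (W : normedZmodType C) (f : H -> W) (M : C) N : 0 < M ->
  (forall x y, f x - f y = f (x - y)) -> (forall x, `|f x| <= M * `|x|) ->
  (forall n (u : A n), (1 <= n)%N -> (N <= n)%N -> f (giota u) = 0) -> forall x, f x = 0.
Proof.
move=> M0 fB fM f0; apply: (@dense_vanish _ _ _ f M (levels N)) => //.
- exact: levels_dense.
- by move=> x y; rewrite fB.
by move=> _ [n [u [n1 Nn ->]]]; apply: f0.
Qed.

(* The norm of [B] is at most 1; the bound 2 is all that continuity needs. *)
Definition is_hook_operator p q (B : {linear H -> H}) : Prop :=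
  (forall n (f : A n), (1 <= n)%N -> B (giota f) = giota (f * hook_idem C p q n)) /\
  (forall x, `|B x| <= 2%:R * `|x|).

Section HookOperatorTheory.
Variables (p q : nat) (B : {linear H -> H}).
Hypothesis BP : is_hook_operator p q B.
Local Notation E := (hook_idem C p q).

Lemma hook_giota n (f : A n) : (1 <= n)%N -> B (giota f) = giota (f * E n).
Proof. by case: BP => h _; apply: h. Qed.

Lemma hook_bound x : `|B x| <= 2%:R * `|x|. Proof. by case: BP. Qed.

Lemma hook_continuous : continuous B.
Proof. by apply: (bounded_continuous (M := 2%:R)) => //; exact: hook_bound. Qed.

Lemma hookT g x : B (T g x) = T g (B x).
Proof.
have [N NP] := G_is_exists g.
apply/eqP; rewrite -subr_eq0; apply/eqP; move: x.
(* From level [N] on, [g] lies in G(n) and acts through [Reg]. *)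
apply: (@levels_vanish _ _ 4%:R N) => // [x y|x|n u n1 /NP[s gs]].
- by rewrite !linearB /= addrACA -opprD.
- rewrite (le_trans (ler_normB _ _)) // T_norm -(T_norm g x).
  rewrite (le_trans (lerD (hook_bound _) (hook_bound _))) // T_norm.
  by rewrite -mulrDl -natrD.
rewrite (T_giota _ n1 gs) !hook_giota // (T_giota _ n1 gs).
by rewrite -!mulrA -hook_idemC !mulrA subrr.
Qed.

Lemma hook_idempotent x : B (B x) = B x.
Proof.
apply/eqP; rewrite -subr_eq0; apply/eqP; move: x.
apply: (@levels_vanish _ _ 6%:R 0) => // [x y|x|n u n1 _].
- by rewrite !linearB /= addrACA -opprD.
- rewrite (le_trans (ler_normB _ _)) //.
  have le4 : `|B (B x)| <= 4%:R * `|x|.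
    by rewrite (le_trans (hook_bound _)) // -[4%N]/(2 * 2)%N natrM -mulrA ler_pM2l ?hook_bound.
  by rewrite (le_trans (lerD le4 (hook_bound _))) // -mulrDl -natrD.
by rewrite !hook_giota // -mulrA hook_idem_idem subrr.
Qed.

Lemma hook_selfadjoint x y : dot (B x) y = dot x (B y).
Proof.
have key m (f : A m) n (g : A n) : (1 <= m)%N -> (1 <= n)%N ->
    dot (B (giota f)) (giota g) = dot (giota f) (B (giota g)).
  move=> m1 n1; have [f' <-] := giota_lift f m1 (leq_maxl m n).
  have [g' <-] := giota_lift g n1 (leq_maxr m n).
  have mn : (1 <= maxn m n)%N by rewrite leq_max m1.
  by rewrite !hook_giota // !dot_giotaE // gstarM gstar_hook_idem mulrA.
(* The added 1 keeps the constant positive when [w] is 0. *)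
have bnd z w : `|dot (B z) w - dot z (B w)| <= (4%:R * `|w| + 1) * `|z|.
  rewrite (le_trans (ler_normB _ _)) //.
  rewrite (le_trans (lerD (dot_bound norm_dot _ _) (dot_bound norm_dot _ _))) //.
  rewrite mulrDl mul1r ler_wpDr // -[4%N]/(2 + 2)%N natrD mulrDl mulrDl lerD //.
    by rewrite -mulrA (mulrC `|w|) mulrA ler_wpM2r // hook_bound.
  by rewrite mulrC ler_wpM2r // hook_bound.
have diff w z z' : dot (B z) w - dot z (B w) - (dot (B z') w - dot z' (B w)) =
    dot (B (z - z')) w - dot (z - z') (B w).
  by rewrite !linearB /= !linearBl addrACA -opprD.
have pos w : 0 < 4%:R * `|w| + 1 by rewrite ltr_wpDl // mulr_ge0.
apply/eqP; rewrite -subr_eq0; apply/eqP; move: x.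
apply: (@levels_vanish _ _ (4%:R * `|y| + 1) 0) => [|z z'|z|n u n1 _];
  [exact: pos|exact: diff|exact: bnd|].
(* Density has now been used for [x]. Conjugation exchanges the two arguments, so that the same
   bound serves for [y]. *)
suff E' : dot (giota u) (B y) = dot (B (giota u)) y by rewrite E' subrr.
apply/eqP; rewrite -subr_eq0; apply/eqP; rewrite (dotC _ _ (B y)) (dotC _ _ y).
rewrite -rmorphB; apply/eqP; rewrite fmorph_eq0; apply/eqP; move: y.
apply: (@levels_vanish _ _ (4%:R * `|giota u| + 1) 0) => [|z z'|z|m v m1 _];
  [exact: pos|exact: diff|exact: bnd|].
by rewrite key // subrr.
Qed.

Lemma hook_fixed x : range B x <-> B x = x.
Proof. by split=> [[y _ <-]|<-]; [exact: hook_idempotent|exists x]. Qed.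

Lemma hook_range_subspace : Defs.subspace (range B).
Proof.
split=> [|c x y /hook_fixed Bx /hook_fixed By]; apply/hook_fixed; first exact: linear0.
by rewrite linearP /= Bx By.
Qed.

(** Used with [S] the range itself, which is thereby closed, and with [S] the union of the images of
    the H^n_pq. *)
Lemma hook_range_closure (S : set H) : S `<=` range B ->
  (forall n (f : A n), (1 <= n)%N -> exists2 y, S y & y = B (giota f)) ->
  range B = closure S.
Proof.
move=> SB BS; apply/seteqP; split=> x.
  move/hook_fixed => Bx; apply/closure_normP => e e0.
  (* The approximation passes through [B], which may double the error. *)
  have e2 : 0 < e / 2%:R by rewrite divr_gt0.
  have [_ [n [f [n1 _ ->]]] xy] := levels_dense 0 x e2.
  have [z Sz zE] := BS n f n1; exists z => //.
  rewrite zE -Bx -linearB (le_lt_trans (hook_bound _)) //.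
  by rewrite mulrC -ltr_pdivlMr.
move/closure_normP => cl; apply/hook_fixed/eqP; rewrite -subr_eq0 -normr_le0.
rewrite real_leNgt ?real0 ?normr_real //; apply/negP => d0.
(* [B] minus the identity is bounded by 2 + 1 and kills the nearby point [y]. *)
have e0 : 0 < `|B x - x| / 3%:R by rewrite divr_gt0.
have [y /SB/hook_fixed By] := cl _ e0; rewrite ltr_pdivlMr // => lt.
have : `|B x - x| <= `|x - y| * 3%:R.
  have -> : B x - x = B (x - y) - (x - y) by rewrite linearB /= By opprB addrA subrK.
  rewrite (le_trans (ler_normB _ _)) // (le_trans (lerD (hook_bound _) (lexx _))) //.
  by rewrite -[3%N]/(2 + 1)%N natrD mulrDr mulr1 mulrC.
by move/(lt_le_trans lt); rewrite ltxx.
Qed.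

Lemma hook_range_closed : closed (range B).
Proof.
have -> : range B = closure (range B); last exact: closed_closure.
apply: hook_range_closure => // n f _; exists (B (giota f)) => //; exact: imageT.
Qed.
End HookOperatorTheory.

Lemma norm_giota n (f : A n) : (1 <= n)%N ->
  `|giota f| ^+ 2 = (n`!%:R)^-1 * gtr (f * gstar f).
Proof. by move=> n1; rewrite norm_dot dot_giotaE. Qed.

Lemma P_la_giota n (nu : diagram n.+1) (f : A n) : (1 <= n)%N ->
  P_la dot iota nu (giota f) = giota (lembed f * didem C nu).
Proof. by move=> n1; rewrite P_laE // -(giota_lembed f n1) coords_giota. Qed.

Lemma transitionP n (la : diagram n) (nu : diagram n.+1) (f : A n) : (1 <= n)%N ->
  f * didem C la = f ->
  `|P_la dot iota nu (giota f)| ^+ 2 = (transition dot iota la nu)%:C * `|giota f| ^+ 2.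
Proof.
move=> n1 fe; pose S := [set r : R | forall xi, (iota n @` Hla la) xi ->
  `|P_la dot iota nu xi| ^+ 2 = r%:C * `|xi| ^+ 2].
suff: S (transition dot iota la nu).
  by apply; exists f => //; apply/Hla_galg.
(* The chosen value has the defining property as soon as some real number has it. *)
apply: xgetPex.
have [a aE] : exists a : C, forall u : A n, u * didem C la = u ->
    lembed u * didem C nu = a *: (emb u * didem C nu).
  have [/adds_boxP[r _ nuE]|lanu] := boolP (adds_box la nu).
    exists (L_scale n k%:~R * (k%:~R + ((row_length la r)%:R - r%:R))) => u ue.
    by rewrite /lembed Lembed_galg (L_component_content _ _ ue nuE).
  exists 0 => u ue; by rewrite /lembed Lembed_galg scale0r (L_component_out _ _ ue lanu).
have [rho rho0 rhoE] := component_norm C la nu.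
(* |a|^2 rho is the ratio of the traces; the factorials account for the measures on S(n) and
   S(n+1). *)
pose r : C := (n.+1`!%:R)^-1 * (`|a| ^+ 2 * rho) * n`!%:R.
have r0 : 0 <= r by rewrite !mulr_ge0 ?invr_ge0 ?ler0n ?exprn_ge0.
exists (complex.Re r) => _ [u /Hla_galg ue <-].
rewrite RRe_real ?ger0_real // P_la_giota // !norm_giota // aE //.
rewrite gstarZ -scalerAl -scalerAr scalerA -normCK linearZ /= rhoE //.
by rewrite /r -[RHS]mulrA [X in _ = _ * X]mulVKf ?fact_neq0 // !mulrA.
Qed.

(** The function differs at [la] and at an addable [nu] only where the transition vanishes, so the
    claim reduces to the transitions from [la] having sum 1. *)
Lemma harmonic_Ypq p q : admissible k (p, q) -> harmonic dot iota (char_Ypq R p q).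
Proof.
move=> adm n n1 la; set xi := giota (didem C la).
have ee := didem_idem C la.
have xi0 : `|xi| ^+ 2 != 0.
  rewrite norm_giota // mulf_neq0 ?invr_eq0 ?fact_neq0 // gtr_norm_eq0.
  exact/cidem_neq0/prim_std.
have change (nu : diagram n.+1) : (transition dot iota la nu)%:C * char_Ypq R p q nu =
    (transition dot iota la nu)%:C * char_Ypq R p q la.
  have [E|ne] := eqVneq (in_Ypq p q la) (in_Ypq p q nu); first by rewrite /char_Ypq E.
  have := transitionP nu n1 ee; rewrite -/xi P_la_giota // /lembed Lembed_galg.
  rewrite (L_component_change _ adm ee ne) linear0 normr0 expr0n /= => /esym/eqP.
  by rewrite mulf_eq0 (negPf xi0) orbF => /eqP ->; rewrite !mul0r.
under eq_bigr do rewrite change.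
rewrite -mulr_suml; suff -> : \sum_(nu | adds_box la nu) (transition dot iota la nu)%:C = 1.
  by rewrite mul1r.
(* The sum is 1 by Pythagoras: the components of the embedded [xi] at addable [nu] are orthogonal,
   the others vanish, and the embedding preserves the norm. *)
apply: (mulIf xi0); rewrite mul1r mulr_suml.
under eq_bigr do rewrite -(transitionP _ n1 ee) P_la_giota // norm_giota //.
rewrite -mulr_sumr /xi -(giota_lembed _ n1) norm_giota //; congr (_ * _).
set v := lembed _; have {3}-> : v = \sum_(nu : diagram n.+1) v * didem C nu.
  by rewrite -mulr_sumr sum_didem mulr1.
rewrite mulr_suml linear_sum /= [RHS](bigID (adds_box la)) /= [X in _ = _ + X]big1 ?addr0.
  by apply: eq_bigr => nu _; rewrite gstarM gstar_didem mulrA -(mulrA v) didem_idem.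
move=> nu lanu; rewrite /v /lembed Lembed_galg.
by rewrite (L_component_out _ _ ee lanu) mul0r linear0.
Qed.

Lemma hook_corresponds p q B : is_hook_operator p q B ->
  corresponds dot iota (char_Ypq R p q) B.
Proof.
move=> BP n n1 x; rewrite !P_nE // (hook_giota BP) // coords_giota //.
rewrite /hook_idem mulr_sumr linear_sum big_mkcond; apply: eq_bigr => la _ /=.
by rewrite P_laE // /char_Ypq; case: ifP; rewrite ?scale1r ?scale0r.
Qed.

(** The compressions fix all matrix coefficients between vectors of one level m. A vector of level n
    lifts to every m >= n, so it is paired there with a dense set. *)
Lemma corresponds_unique (a : forall n, diagram n -> C) (A B : {linear H -> H}) :
  continuous A -> continuous B ->
  corresponds dot iota a A -> corresponds dot iota a B -> B =1 A.
Proof.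
move=> Ac Bc Aa Ba.
have [M M0 AM] := continuous_bounded Ac; have [M' M0' BM] := continuous_bounded Bc.
move=> x; apply/eqP; rewrite -subr_eq0; apply/eqP; move: x.
apply: (@levels_vanish _ _ (M' + M) 0) => [|x y|x|n u n1 _].
- exact: addr_gt0.
- by rewrite !linearB /= addrACA -opprD.
- by rewrite (le_trans (ler_normB _ _)) // mulrDl lerD.
set w := _ - _; apply: (@dot_self0 _ _ _ norm_dot).
suff: forall y, dot y w = 0 by [].
apply: (@levels_vanish _ _ (`|w| + 1) n) => [|x y|x|m v m1 nm].
- by rewrite ltr_wpDl.
- by rewrite linearBl.
- by rewrite (le_trans (dot_bound norm_dot _ _)) // mulrC ler_wpM2r // lerDl.
have [u' uE] := giota_lift u n1 nm.
have PE : P_n dot iota m (giota u') = giota u' by rewrite P_nE // coords_giota.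
have := Ba m m1 (giota u'); rewrite -(Aa m m1 (giota u')) PE // !P_nE // => E.
rewrite dotC dot_giotar // /w -uE linearB /=.
suff -> : coords m (B (giota u')) = coords m (A (giota u')).
  by rewrite subrr mul0r linear0 mulr0 rmorph0.
by rewrite -(coords_giota (coords m (B _)) m1) E coords_giota.
Qed.

Lemma hook_orth p q p' q' B B' : admissible k (p, q) -> admissible k (p', q') ->
  (p, q) != (p', q') -> is_hook_operator p q B -> is_hook_operator p' q' B' ->
  forall x y, range B x -> range B' y -> dot x y = 0.
Proof.
move=> a a' ne BP BP' x y /(hook_fixed BP) <- /(hook_fixed BP') <-.
rewrite (hook_selfadjoint BP) (_ : B (B' y) = 0) ?linear0r //; move: y.
apply: (@levels_vanish _ _ 4%:R 0) => // [y z|z|n u n1 _].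
- by rewrite !linearB.
- rewrite (le_trans (hook_bound BP _)) // -[4%N]/(2 * 2)%N natrM -mulrA ler_pM2l //.
  exact: hook_bound BP' z.
by rewrite (hook_giota BP') // (hook_giota BP) // -mulrA hook_idemC
  (hook_idem_orth _ _ a a') // mulr0 linear0.
Qed.

End InductiveLimit.

(** * The decomposition of T_k *)

Lemma Hnpq_galg (R : realType) n p q (f : galg R[i] 'S_n) :
  Hnpq p q f <-> f * hook_idem R[i] p q n = f.
Proof.
split=> [[h hP fE]|/hook_idemP[h hP fE]].
  by apply/hook_idemP; exists h => // la; apply/Hla_galg.
by exists h => // la; apply/Hla_galg.
Qed.

Theorem theorem5p7p1 (R : realType) (k : int)
    (H : completeNormedModType R[i]) (dot : {dot H for Num.conj})
    (norm_dot : forall x : H, `|x| ^+ 2 = dot x x)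
    (iota : forall n, {linear L2 R n -> H}) (T : G -> {linear H -> H})
    (T_k : is_T dot iota k%:~R T) :
  exists A : nat * nat -> {linear H -> H},
    [/\ (* (i) *)
        forall p q, admissible k (p, q) ->
          [/\ harmonic dot iota (char_Ypq R p q),
              in_commutant T (A (p, q)),
              corresponds dot iota (char_Ypq R p q) (A (p, q))
            & forall B : {linear H -> H}, in_commutant T B ->
                corresponds dot iota (char_Ypq R p q) B -> B =1 A (p, q)],
        (* (ii) *)
        [/\ forall pq, admissible k pq -> is_orth_projection dot (A pq),
            hilbert_direct_sum dot
              (fun i : {pq : nat * nat | admissible k pq} => range (A (sval i)))
          & forall pq, admissible k pq ->
              unitary_rep_on dot T (range (A pq))]
      & (* (iii) *)
        forall p q, admissible k (p, q) ->
          (forall n, (maxn 1 (p * q) <= n)%N -> forall f : L2 R n,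
             Hnpq p q f -> Hnpq p q (Lembed k%:~R f)) /\
          is_inductive_limit dot iota k%:~R (maxn 1 (p * q))
            (fun n => @Hnpq R n p q) T (range (A (p, q)))].
Proof.
(* Couples that are not admissible get the zero operator as a default. *)
have /choice[A AP] : forall pq : nat * nat, exists B : {linear H -> H},
    admissible k pq -> is_hook_operator iota pq.1 pq.2 B.
  move=> [p q]; have [adm|] := boolP (admissible k (p, q)); last by exists \0.
  by have [B BP] := hook_operator_exists norm_dot T_k adm; exists B.
have Hembed p q : admissible k (p, q) -> forall n (f : L2 R n),
    Hnpq p q f -> Hnpq p q (Lembed k%:~R f).
  move=> adm n f /Hnpq_galg fE; apply/Hnpq_galg.
  exact: etrans (esym (lembed_hook adm f)) (congr1 (@lembed R k n) fE).
have A_unitary pq : admissible k pq -> unitary_rep_on dot T (range (A pq)).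
  move=> adm; have BP := AP pq adm; have [Tst T1 Tm Td] := il_unitary T_k.
  split=> [g _ [x _ <-]|x _|g h x _|g x y _ _].
  - by exists (T g x) => //; exact: (hookT norm_dot T_k BP).
  - exact: T1.
  - exact: Tm.
  exact: Td.
exists A; split.
- move=> p q adm; have BP : is_hook_operator iota p q (A (p, q)) := AP _ adm.
  split.
  + exact: harmonic_Ypq norm_dot T_k p q adm.
  + split; first exact: hook_continuous BP.
    by move=> g x; exact: (hookT norm_dot T_k BP).
  + exact: hook_corresponds norm_dot T_k p q _ BP.
  move=> B [Bc _]; apply: (corresponds_unique norm_dot T_k) => //.
    exact: hook_continuous BP.
  exact: hook_corresponds norm_dot T_k p q _ BP.
- split=> [pq adm||//].
    have BP := AP pq adm; split=> x; first exact: (hook_idempotent T_k BP).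
    by move=> y; exact: (hook_selfadjoint norm_dot T_k BP).
  split=> [[pq adm]|[pq adm] [pq' adm'] ne|].
  + split; first exact: (hook_range_subspace T_k (AP pq adm)).
    exact: (hook_range_closed T_k (AP pq adm)).
  + case: pq adm ne => p q adm ne; case: pq' adm' ne => p' q' adm' ne.
    apply: (hook_orth norm_dot T_k adm adm' _ (AP _ adm) (AP _ adm')).
    by apply/eqP => E; apply: ne; apply/val_inj.
  apply/seteqP; split=> // x _; apply/closure_normP => e e0.
  have [_ [n [f [n1 _ ->]]] xy] := levels_dense T_k 1 x e0.
  exists (giota iota f) => //.
  (* Each diagram with n boxes lies in exactly one admissible Y(p,q), so a vector of level n is the
     sum of its images under the finitely many A_pq that [idx] reaches. *)
  have /choice[idx idxP] : forall la : diagram n, exists i : {pq | admissible k pq},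
      in_Ypq (sval i).1 (sval i).2 la.
    move=> la; have [pq [adm Y]] := in_Ypq_exists k la n1.
    by exists (exist _ pq adm).
  have idxE i la : in_Ypq (sval i).1 (sval i).2 la = (idx la == i).
    apply/idP/eqP => [Y|<-]; last exact: idxP.
    case: i (idx la) (idxP la) Y => [[p q] adm] [[p' q'] adm'] /= Y' Y.
    by apply/val_inj/(in_Ypq_uniq adm' adm Y' Y).
  exists (undup [seq idx la | la <- enum {: diagram n}]), (fun i => A (sval i) (giota iota f)).
    by move=> i; exists (giota iota f).
  have fE : giota iota f = \sum_la giota iota (f * didem R[i] la).
    by rewrite -linear_sum -mulr_sumr sum_didem mulr1.
  transitivity (\sum_(i <- undup [seq idx la | la <- enum {: diagram n}])
      \sum_la if idx la == i then giota iota (f * didem R[i] la) else 0).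
    rewrite exchange_big fE; apply: eq_bigr => la _ /=.
    have idx_in : idx la \in undup [seq idx mu | mu <- enum {: diagram n}].
      by rewrite mem_undup map_f // mem_enum.
    rewrite (bigD1_seq (idx la)) ?undup_uniq // eqxx big1 /= ?addr0 // => i.
    by rewrite eq_sym => /negPf ->.
  apply: eq_bigr => i _; rewrite (hook_giota (AP _ (svalP i))) // /hook_idem.
  rewrite mulr_sumr linear_sum [RHS]big_mkcond; apply: eq_bigr => la _.
  by rewrite idxE.
move=> p q adm; have BP : is_hook_operator iota p q (A (p, q)) := AP _ adm.
split=> [n _|]; first exact: Hembed.
have n_ge1 n : (maxn 1 (p * q) <= n)%N -> (1 <= n)%N by rewrite geq_max => /andP[].
split.
- move=> n _; split=> [|c f g]; first by apply/Hnpq_galg; exact: mul0r.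
  move=> /Hnpq_galg fE /Hnpq_galg gE; apply/Hnpq_galg.
  pose f' : galg R[i] 'S_n := f; pose g' : galg R[i] 'S_n := g.
  have: (c *: f' + g') * hook_idem R[i] p q n = c *: f' + g'.
    by rewrite mulrDl -scalerAl [f' * _]fE [g' * _]gE.
  exact.
- move=> n _ s f /Hnpq_galg fE; apply/Hnpq_galg; rewrite Reg_galg.
  exact: hook_idem_translate.
- by move=> n _; exact: Hembed.
- by move=> n /n_ge1 n1 f g _ _; exact: (il_isometry T_k).
- by move=> n /n_ge1 n1 f _; exact: (il_compat T_k).
- apply: (hook_range_closure T_k BP) => [_ [n /= /n_ge1 n1 [f /Hnpq_galg fE <-]]|n f n1].
    by apply/(hook_fixed T_k BP); rewrite [LHS](hook_giota BP f n1) fE.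
  (* A vector of a low level is rewritten at a level past the threshold; its image in [H] is the
     same. *)
  have [f' <-] := giota_lift T_k f n1 (leq_maxl n (maxn 1 (p * q))).
  have n1' : (1 <= maxn n (maxn 1 (p * q)))%N by rewrite leq_max n1.
  rewrite (hook_giota BP) //; eexists; last by reflexivity.
  exists (maxn n (maxn 1 (p * q))); first exact: leq_maxr.
  eexists; last by reflexivity.
  by apply/Hnpq_galg; rewrite -mulrA hook_idem_idem.
- exact: A_unitary.
by move=> n /n_ge1 n1 g s gs f _; exact: (il_equivariant T_k).
Qed.
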